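(* Let $G$ be a tree on $n$ nodes and let $\mathcal{L}_G$ be the linear space of symmetric matrices given by $G$. Then $\dim\mathrm{GV}(\mathcal{L}_G)=3n-3$.
   Context: $\mathbb{S}^n$ denotes the real vector space of real symmetric $n\times n$ matrices. For a simple undirected graph $G$ on nodes $1,\ldots,n$, $\mathcal{L}_G\subset\mathbb{S}^n$ is the linear space of all $A=(a_{ij})\in\mathbb{S}^n$ with $a_{ij}=0$ whenever $i\neq j$ and there is no edge between $i$ and $j$ in $G$ (diagonal entries are unconstrained). The Gibbs variety $\mathrm{GV}(\mathcal{L}_G)$ is the Zariski closure of $\{\exp(A): A\in\mathcal{L}_G\}$ (matrix exponential) in $\mathbb{C}^{\binom{n+1}{2}}$, the space of complex symmetric $n\times n$ matrices.
   Formalization: The tree is assumed to have n ≥ 2 nodes: for n = 1 the space is all of R, its Gibbs variety is the complex line of dimension 1, and the formula 3n−3 = 0 fails. *)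

(* Defs.v *)
From HB Require Import structures.
From mathcomp Require Import all_boot all_order all_algebra.
From mathcomp Require Import all_classical all_reals all_analysis.
From mathcomp Require Import complex.
(* Not imported: its notations clash with those of mathcomp-analysis. *)
From mathcomp Require mpoly.

Set Implicit Arguments.
Unset Strict Implicit.
Unset Printing Implicit Defensive.

Import Order.TTheory GRing.Theory Num.Theory.
Import numFieldNormedType.Exports.

Local Open Scope classical_set_scope.
Local Open Scope ring_scope.

Definition simple_graph (V : finType) (e : rel V) : Prop :=
  symmetric e /\ irreflexive e.

(* In a simple graph, a closed walk x, y, x is an [e]-cycle of size 2, hence the
   bound: graph-theoretic cycles are the duplicate-free ones of size >= 3. *)
Definition acyclic_graph (V : finType) (e : rel V) : Prop :=
  forall c : seq V, ucycle e c -> (size c <= 2)%N.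

Definition connected_graph (V : finType) (e : rel V) : Prop :=
  forall x y : V, connect e x y.

Definition is_tree (V : finType) (e : rel V) : Prop :=
  [/\ simple_graph e, connected_graph e & acyclic_graph e].

Definition graph_space (R : realType) (n : nat) (e : rel 'I_n) : set 'M[R]_n :=
  [set A | A^T = A /\ forall i j, i != j -> ~~ e i j -> A i j = 0].
Arguments graph_space R {n} e _.

Definition expmx (R : realType) (n : nat) (A : 'M[R]_n) : 'M[R]_n :=
  lim (series (fun k => (k`!%:R)^-1 *: A ^+ k) @ \oo).

Section Zariski.
Variables (K : fieldType) (N : nat).
Implicit Types A B S V Z : set 'rV[K]_N.

Definition zariski_closed Z : Prop :=
  exists F : set (mpoly.mpoly N K),
    Z = [set x | forall f, F f -> mpoly.meval (fun k => x 0 k) f = 0].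

Definition zariski_closure S : set 'rV[K]_N := smallest zariski_closed S.

Definition zariski_irreducible Z : Prop :=
  [/\ zariski_closed Z, Z !=set0 &
      forall A B, zariski_closed A -> zariski_closed B ->
        Z = A `|` B -> Z = A \/ Z = B].

Definition zariski_chain V (k : nat) (c : nat -> set 'rV[K]_N) : Prop :=
  (forall i, (i <= k)%N -> zariski_irreducible (c i) /\ c i `<=` V) /\
  (forall i, (i < k)%N -> c i `<` c i.+1).

(* Krull dimension of the Zariski closed set V: the supremum of the lengths k of
   chains Z_0 < ... < Z_k of irreducible closed subsets of V (-oo for the empty
   set). Since the index set of the supremum consists of natural numbers, the
   real field R only serves as a carrier for extended numbers. *)
Definition zariski_dim (R : realType) V : \bar R :=
  ereal_sup [set (k%:R)%:E | k in [set k : nat | exists c, zariski_chain V k c]].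

End Zariski.

(* Coordinates x_ij, i <= j, on the space of complex symmetric matrices. *)
Definition upper_index (n : nat) : {set 'I_n * 'I_n} :=
  [set p : 'I_n * 'I_n | (p.1 <= p.2)%N].

Lemma card_upper_index (n : nat) : #|upper_index n| = 'C(n.+1, 2).
Proof.
rewrite -sum1dep_card -(pair_big_dep xpredT (fun i j : 'I_n => (i <= j)%N)
  (fun _ _ => 1%N)) /=.
rewrite (exchange_big_dep xpredT) //= -bin2_sum big_mkord big_ord_recl add0n.
apply: eq_bigr => j _; rewrite sum1dep_card.
have widen_inj : injective (widen_ord (ltn_ord j)).
  by move=> a b [/= eqab]; apply: val_inj.
rewrite -[RHS]card_ord -(card_imset _ widen_inj).
apply: eq_card => i; rewrite inE; apply/idP/imsetP => [le_ij | [k _ ->]].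
  by exists (Ordinal (le_ij : (i < j.+1)%N)) => //; apply: val_inj.
by rewrite -ltnS /= ltn_ord.
Qed.

Definition sym_coord (T : Type) (n : nat) (X : 'M[T]_n) :
    'rV[T]_(#|upper_index n|) :=
  \row_k X (enum_val k).1 (enum_val k).2.

Lemma sym_coord_inj (T : Type) (n : nat) (X Y : 'M[T]_n) :
  X^T = X -> Y^T = Y -> sym_coord X = sym_coord Y -> X = Y.
Proof.
move=> sX sY /rowP eqXY.
have upper (i j : 'I_n) : (i <= j)%N -> X i j = Y i j.
  move=> le_ij; have ij : (i, j) \in upper_index n by rewrite inE.
  by have := eqXY (enum_rank_in ij (i, j)); rewrite !mxE enum_rankK_in.
apply/matrixP => i j; have [/upper //|/ltnW /upper] := leqP i j.
by move=> eqji; rewrite -sX -sY !mxE.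
Qed.

Definition gibbs_variety (R : realType) (n : nat) (L : set 'M[R]_n) :
    set 'rV[complex R]_(#|upper_index n|) :=
  zariski_closure
    [set sym_coord (map_mx (real_complex R) (expmx A)) | A in L].

(* Main.v *)
Require Import Defs.
From mathcomp Require Import all_boot all_order all_algebra fingroup perm.
From mathcomp Require Import all_classical all_reals all_analysis.
From mathcomp Require Import complex zify.
From mathcomp Require Import -(notations) mpoly.

(** The Gibbs variety of a tree [G] is the closure of the image of a polynomial map
    [gibbs_param] with [3 * n - 3] parameters and injective derivative at some
    point, and such a closure has as dimension the number of parameters.

    The parametrization. By the spectral theorem the exponential of a real symmetric
    matrix [A] is a polynomial [c(A)] in [A] of degree less than [n]
    ([expmx_matpoly]). Conversely a polynomial [f] vanishing at all exponentials
    vanishes at all matrices [c(A)] ([vanish_on_matpoly]): if the sums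
    of few eigenvalues of [A] are pairwise distinct, the exponentials of the
    multiples [k A] are the values at the powers [z i = exp (k * lam i)] of the
    linear family of matrices with the eigenvectors of [A] and eigenvalues [z i],
    and distinct geometric progressions being linearly independent,
    [f] vanishes on that family, which contains [c(A)]; the matrices with such
    eigenvalues are dense, being the nonzeros of a symmetric polynomial in the
    eigenvalues. So the Gibbs variety is the closure of the matrices [c(A)]. As
    affine substitutions in [c] allow to normalize [A] by [A u u = 0] and
    [A u v = 1] for an edge [(u, v)], there remain [n] parameters for [c] and
    [2 * n - 3] for [A], a tree having [n - 1] edges ([card_edge_set]).

    The derivative. At ['X] and [A] it is [(c, B) |-> c(A) + B], with [B] supported on
    the tree and [B u u = B u v = 0]. If this vanishes then [B] commutes with [A].
    For a tree the entries of [A *m B] and [B *m A] at two vertices at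
    distance two have a single nonzero term, which forces [B] to be a combination
    of [1%:M] and [A] ([tree_commutant]), hence zero. The powers of [A]
    being independent for a suitable [A] ([exists_powers_free]), [c] is zero too.

    The dimension. If [Z 0], ..., [Z k] is a strict chain of irreducible closed sets,
    polynomials [f j] vanishing on [Z j] but not on [Z j.+1] are algebraically
    independent on [Z k] ([chain_alg_indep]), whereas more than [m] polynomials in [m]
    parameters are dependent ([alg_dependent]); this bounds the length of chains
    in the closure of an image of an [m]-dimensional space. Conversely, the
    closures of the images of a flag of affine subspaces through a point where the
    derivative is injective form a chain of length [m], strict for the same
    reason ([zariski_chain_of_immersion]). *)

Set Implicit Arguments.
Unset Strict Implicit.
Unset Printing Implicit Defensive.

Import Order.TTheory GRing.Theory Num.Theory.
Import numFieldNormedType.Exports.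

Local Open Scope classical_set_scope.
Local Open Scope ring_scope.

(** * Polynomial functions *)

Definition rvec (K : Type) m (x : 'rV[K]_m) : 'I_m -> K := fun k => x 0 k.

Definition polyfun (K : comNzRingType) m (f : 'rV[K]_m -> K) : Prop :=
  exists p : mpoly m K, forall x, f x = meval (rvec x) p.

Definition polymap (K : comNzRingType) m N (psi : 'rV[K]_m -> 'rV[K]_N) : Prop :=
  forall j, polyfun (fun x => psi x 0 j).

Section PolynomialFunctions.
Variables (K : comNzRingType) (m : nat).
Implicit Types f g : 'rV[K]_m -> K.

Lemma eq_polyfun f g : f =1 g -> polyfun f -> polyfun g.
Proof. by move=> fg [p Hp]; exists p => x; rewrite -fg. Qed.

Lemma polyfun_const (c : K) : polyfun (fun _ : 'rV[K]_m => c).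
Proof. by exists (mpolyC m c) => x; rewrite mevalC. Qed.

Lemma polyfun_coord (i : 'I_m) : polyfun (fun x : 'rV[K]_m => x 0 i).
Proof. by exists (mpolyX K (mnm1 i)) => x; rewrite mevalXU. Qed.

Lemma polyfunD f g : polyfun f -> polyfun g -> polyfun (fun x => f x + g x).
Proof. by move=> [p Hp] [q Hq]; exists (p + q) => x; rewrite Hp Hq mevalD. Qed.

Lemma polyfunM f g : polyfun f -> polyfun g -> polyfun (fun x => f x * g x).
Proof. by move=> [p Hp] [q Hq]; exists (p * q) => x; rewrite Hp Hq mevalM. Qed.

Lemma polyfun_sum (I : Type) (r : seq I) (P : pred I) (F : I -> 'rV[K]_m -> K) :
  (forall i, polyfun (F i)) -> polyfun (fun x => \sum_(i <- r | P i) F i x).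
Proof.
move=> HF; elim: r => [|i r IH].
  by apply: eq_polyfun (polyfun_const 0) => x; rewrite big_nil.
have H : polyfun (fun x => if P i then F i x + \sum_(j <- r | P j) F j x
                           else \sum_(j <- r | P j) F j x).
  by case: (P i) => //; apply: polyfunD.
by apply: eq_polyfun H => x; rewrite big_cons.
Qed.

Lemma polyfun_exp f k : polyfun f -> polyfun (fun x => f x ^+ k).
Proof.
move=> Hf; elim: k => [|k IH].
  by apply: eq_polyfun (polyfun_const 1) => x; rewrite expr0.
by apply: eq_polyfun (polyfunM Hf IH) => x; rewrite exprS.
Qed.

Lemma polyfun_prod (I : Type) (r : seq I) (P : pred I) (F : I -> 'rV[K]_m -> K) :
  (forall i, polyfun (F i)) -> polyfun (fun x => \prod_(i <- r | P i) F i x).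
Proof.
move=> HF; elim: r => [|i r IH].
  by apply: eq_polyfun (polyfun_const 1) => x; rewrite big_nil.
have H : polyfun (fun x => if P i then F i x * \prod_(j <- r | P j) F j x
                           else \prod_(j <- r | P j) F j x).
  by case: (P i) => //; apply: polyfunM.
by apply: eq_polyfun H => x; rewrite big_cons.
Qed.

Lemma polyfun_meval k (P : mpoly k K) (F : 'I_k -> 'rV[K]_m -> K) :
  (forall i, polyfun (F i)) -> polyfun (fun x => meval (fun i => F i x) P).
Proof.
move=> HF; apply: eq_polyfun (fun x => esym (mevalE (fun i => F i x) P)) _.
apply: polyfun_sum => a; apply: polyfunM; first exact: polyfun_const.
by apply: polyfun_prod => i; apply: polyfun_exp.
Qed.

End PolynomialFunctions.

Lemma polyfun_comp (K : comNzRingType) m N (psi : 'rV[K]_m -> 'rV[K]_N) f :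
  polyfun f -> polymap psi -> polyfun (f \o psi).
Proof.
move=> [p Hp] Hpsi.
by apply: eq_polyfun (polyfun_meval p Hpsi) => x /=; rewrite Hp.
Qed.

Lemma polymap_comp (K : comNzRingType) l m N
    (phi : 'rV[K]_l -> 'rV[K]_m) (psi : 'rV[K]_m -> 'rV[K]_N) :
  polymap phi -> polymap psi -> polymap (psi \o phi).
Proof. by move=> Hphi Hpsi j; apply: polyfun_comp (Hpsi j) Hphi. Qed.

Lemma polyfun_line (K : comNzRingType) m (f : 'rV[K]_m -> K) (x v : 'rV[K]_m) :
  polyfun f -> exists q : {poly K}, forall t, f (x + t *: v) = q.[t].
Proof.
move=> [p Hp].
exists (\sum_(a <- msupp p)
  (mcoeff a p)%:P * \prod_i ((x 0 i)%:P + (v 0 i)%:P * 'X) ^+ a i) => t.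
rewrite Hp mevalE horner_sum; apply: eq_bigr => a _.
rewrite hornerM hornerC horner_prod; congr (_ * _); apply: eq_bigr => i _.
by rewrite horner_exp hornerD hornerM !hornerC hornerX /rvec !mxE [t * _]mulrC.
Qed.

Section NumberField.
Variable K : numDomainType.

Lemma poly_nat_roots (q : {poly K}) : (forall k : nat, q.[k%:R] = 0) -> q = 0.
Proof.
move=> Hq; apply/eqP; apply: contraT => q0.
suff: (size [seq k%:R : K | k <- iota 0 (size q)] < size q)%N.
  by rewrite size_map size_iota ltnn.
apply: max_poly_roots => //; first by apply/allP => _ /mapP[k _ ->]; apply/rootP.
rewrite map_inj_uniq ?iota_uniq // => i j /eqP.
by rewrite eqr_nat => /eqP.
Qed.

(** The coordinates are freed one at a time, each time along a line, on which a
    polynomial with infinitely many zeros vanishes. *)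
Lemma polyfun_nat_zero m (f : 'rV[K]_m -> K) : polyfun f ->
  (forall y : 'I_m -> nat, f (\row_i (y i)%:R) = 0) -> forall x, f x = 0.
Proof.
move=> Hf Hnat.
suff main (j : nat) : forall (x : 'rV[K]_m) (y : 'I_m -> nat),
    (forall i : 'I_m, (j <= i)%N -> x 0 i = (y i)%:R) -> f x = 0.
  by move=> x; apply: (main m x (fun=> 0%N)) => i; rewrite leqNgt ltn_ord.
elim: j => [|j IH] x y Hxy.
  by rewrite -(Hnat y); congr (f _); apply/rowP => i; rewrite mxE Hxy.
have [ltjm|lemj] := ltnP j m; last first.
  apply: (IH x y) => i leji.
  by move: (leq_ltn_trans (leq_trans lemj leji) (ltn_ord i)); rewrite ltnn.
pose i0 := Ordinal ltjm; pose v : 'rV[K]_m := delta_mx 0 i0.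
have [q Hq] := polyfun_line (x - x 0 i0 *: v) v Hf.
have q0 : q = 0.
  apply: poly_nat_roots => k; rewrite -Hq.
  apply: (IH _ (fun i => if i == i0 then k else y i)) => i leji.
  rewrite !mxE eqxx /=; case: eqVneq => [-> | ne_i].
    by rewrite !mulr1 subrr add0r.
  rewrite !mulr0 subr0 addr0 Hxy // ltn_neqAle leji andbT.
  by apply: contra ne_i => /eqP ji; apply/eqP/val_inj.
by have := Hq (x 0 i0); rewrite q0 horner0 subrK.
Qed.

(** Polynomial functions form an integral domain: restrict both to the line
    through an arbitrary point and a point where the first one is nonzero. *)
Lemma polyfun_mul_eq0 m (f g : 'rV[K]_m -> K) : polyfun f -> polyfun g ->
  (forall x, f x * g x = 0) -> (forall x, f x = 0) \/ (forall x, g x = 0).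
Proof.
move=> Hf Hg fg0; have [[x0 fx0]|/forallNP Hf0] := pselect (exists x, f x != 0); last first.
  by left => x; have /negP/negPn/eqP := Hf0 x.
right => x.
have [p Hp] := polyfun_line x0 (x - x0) Hf.
have [q Hq] := polyfun_line x0 (x - x0) Hg.
have pq0 : p * q = 0.
  by apply: poly_nat_roots => k; rewrite hornerM -Hp -Hq fg0.
have /eqP := pq0; rewrite mulf_eq0 => /orP[] /eqP H0.
  by move: fx0; have := Hp 0; rewrite H0 horner0 scale0r addr0 => ->; rewrite eqxx.
by have := Hq 1; rewrite H0 horner0 scale1r addrC subrK.
Qed.

End NumberField.

(** * Algebraic independence *)

Section AlgebraicIndependence.
Variable K : fieldType.

(** The functions [f j] vanish on [Z j] but not on the larger irreducible set
    [Z j.+1]. If [P] vanished at them on [Z k], then the monomials of least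
    exponent in [f (k-1)] could be isolated: divide by that power of [f (k-1)]
    (allowed on the irreducible set [Z k]) and restrict to [Z (k-1)]. Iterating
    down to the nonempty [Z 0] isolates a single monomial of [P]. *)
Lemma chain_alg_indep N k (Z : nat -> set 'rV[K]_N) (f : 'I_k -> 'rV[K]_N -> K)
    (P : mpoly k K) :
  Z 0%N !=set0 ->
  (forall j : 'I_k, Z j `<=` Z j.+1) ->
  (forall (j : 'I_k) g h, polyfun g -> polyfun h ->
    (forall x, Z j.+1 x -> g x * h x = 0) ->
    (forall x, Z j.+1 x -> g x = 0) \/ (forall x, Z j.+1 x -> h x = 0)) ->
  (forall j, polyfun (f j)) ->
  (forall (j : 'I_k) x, Z j x -> f j x = 0) ->
  (forall j, exists2 x, Z (nat_of_ord j).+1 x & f j x != 0) ->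
  (forall x, Z k x -> meval (fun j => f j x) P = 0) -> P = 0.
Proof.
move=> [z0 Zz0] Zsub Zprime Hf fZ fN HP; apply/eqP/negP => /negP P0.
have [a0 Pa0] : exists a, a \in msupp P.
  by move: P0; rewrite -msupp_eq0; case: (msupp P) => // a s _; exists a; rewrite inE eqxx.
pose agree (j : nat) (a b : multinom k) := [forall i : 'I_k, (j <= i)%N ==> (b i == a i)].
suff main (l : nat) : (l <= k)%N -> exists2 a, a \in msupp P &
    forall x, Z (k - l)%N x -> \sum_(b <- msupp P | agree (k - l)%N a b)
      mcoeff b P * \prod_(i < k | (i < k - l)%N) f i x ^+ b i = 0.
  have [a Pa] := main k (leqnn k); rewrite subnn => /(_ _ Zz0).
  rewrite (eq_bigl (pred1 a)); last first.
    move=> b; apply/forallP/eqP => [ab | -> i]; last by rewrite eqxx.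
    by apply/mnmP => i; apply/eqP; have := ab i; rewrite leq0n.
  rewrite -big_filter filter_pred1_uniq ?msupp_uniq // big_seq1.
  rewrite big_pred0 ?mulr1; last by move=> i; rewrite ltn0.
  by move/eqP; rewrite mcoeff_eq0 Pa.
elim: l => [|l IH] lelk.
  exists a0 => // x; rewrite subn0 => Zx; rewrite -[RHS](HP x Zx) mevalE.
  apply: eq_big => [b|b _]; first by apply/forallP => i; rewrite leqNgt ltn_ord.
  by congr (_ * _); apply: eq_bigl => i; rewrite ltn_ord.
have [a Pa Ha] := IH (ltnW lelk).
pose j := (k - l.+1)%N.
have ltjk : (j < k)%N by rewrite /j ltn_subrL (leq_ltn_trans _ lelk).
have Ej : (k - l)%N = j.+1 by rewrite /j -subSn // subSS.
pose jo := Ordinal ltjk; rewrite -/j; rewrite Ej in Ha.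
have agree_refl i b : agree i b b by apply/forallP => ?; rewrite eqxx implybT.
(* Among the monomials left, [a'] has the least exponent in [f j]. *)
have [a' /andP[Pa' aa'] a'min] : exists2 a', (a' \in msupp P) && agree j.+1 a a' &
    forall b, b \in msupp P -> agree j.+1 a b -> (a' jo <= b jo)%N.
  pose Q e := has (fun b => agree j.+1 a b && (b jo == e)) (msupp P).
  have exQ : exists e, Q e.
    by exists (a jo); apply/hasP; exists a => //; rewrite agree_refl eqxx.
  case: (ex_minnP exQ) => e /hasP[a' Pa' /andP[aa' /eqP ea']] emin.
  exists a'; first by rewrite Pa' aa'.
  move=> b Pb ab; rewrite ea'; apply: emin; apply/hasP.
  by exists b => //; rewrite ab eqxx.
pose g x := f jo x ^+ a' jo.
pose h x := \sum_(b <- msupp P | agree j.+1 a b) mcoeff b P *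
  (f jo x ^+ (b jo - a' jo) * \prod_(i < k | (i < j)%N) f i x ^+ b i).
have Hg : polyfun g by apply: polyfun_exp.
have Hh : polyfun h.
  apply: polyfun_sum => b; apply: polyfunM; first exact: polyfun_const.
  apply: polyfunM; first exact: polyfun_exp.
  by apply: polyfun_prod => i; apply: polyfun_exp.
have gh0 x : Z j.+1 x -> g x * h x = 0.
  move=> Zx; rewrite -[RHS](Ha x Zx) /h mulr_sumr big_seq_cond [RHS]big_seq_cond.
  apply: eq_bigr => b /andP[Pb ab].
  rewrite [in RHS](bigD1 jo) //= mulrCA; congr (_ * _); rewrite mulrA -exprD.
  rewrite subnKC ?a'min //; congr (_ * _); apply: eq_bigl => i.
  by rewrite ltnS [in RHS]leq_eqVlt -val_eqE /=; case: ltngtP.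
have [g0|h0] := Zprime jo _ _ Hg Hh gh0.
  by have [x /g0/eqP] := fN jo; rewrite expf_eq0 => /andP[_ ->].
have aa'E b : agree j a' b = agree j.+1 a b && (b jo == a' jo).
  apply/forallP/andP => [Hb | [/forallP ab /eqP bj] i].
    split; last by have := Hb jo; rewrite leqnn.
    apply/forallP => i; apply/implyP => ltji.
    have /implyP/(_ (ltnW ltji))/eqP-> := Hb i.
    by move/forallP: aa' => /(_ i); rewrite ltji.
  rewrite leq_eqVlt; case: eqVneq => [ji | _] /=.
    by have -> : i = jo by [exact: val_inj]; rewrite bj.
  apply/implyP => ltji; move: (ab i); rewrite ltji => /eqP->.
  by move/forallP: aa' => /(_ i); rewrite ltji => /eqP->.
exists a' => // x Zx; rewrite -[RHS](h0 x (Zsub jo x Zx)) /h.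
rewrite [RHS](bigID (fun b : multinom k => b jo == a' jo)) /= [X in _ + X]big1_seq ?addr0.
  by apply: eq_big => [b|b]; rewrite aa'E // => /andP[_ /eqP->]; rewrite subnn expr0 mul1r.
move=> b /andP[/andP[ab bj] Pb]; rewrite (fZ jo x Zx) expr0n subn_eq0.
by rewrite leqNgt ltn_neqAle eq_sym bj a'min //= mul0r mulr0.
Qed.

End AlgebraicIndependence.

Lemma polymap_range_prime (K : numFieldType) m N (psi : 'rV[K]_m -> 'rV[K]_N) g h :
  polymap psi -> polyfun g -> polyfun h ->
  (forall x, range psi x -> g x * h x = 0) ->
  (forall x, range psi x -> g x = 0) \/ (forall x, range psi x -> h x = 0).
Proof.
move=> Hpsi Hg Hh gh0.
have gh x : (g \o psi) x * (h \o psi) x = 0 by apply: gh0; exists x.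
have [H|H] := polyfun_mul_eq0 (polyfun_comp Hg Hpsi) (polyfun_comp Hh Hpsi) gh;
  by [left => _ [x _ <-]; apply: H | right => _ [x _ <-]; apply: H].
Qed.

(** This is [chain_alg_indep] for the flag of coordinate subspaces and the
    coordinate functions. *)
Lemma mpoly_eval0 (K : numFieldType) k (P : mpoly k K) :
  (forall x : 'rV[K]_k, meval (rvec x) P = 0) -> P = 0.
Proof.
move=> HP.
pose pr j (x : 'rV[K]_k) := \row_(i < k) if (i < j)%N then x 0 i else 0.
have Hpr j : polymap (pr j).
  move=> i; case: (ltnP i j) => ij.
    by apply: eq_polyfun (polyfun_coord K i) => x; rewrite mxE ij.
  by apply: eq_polyfun (polyfun_const k 0) => x; rewrite mxE ltnNge ij.
apply: (@chain_alg_indep _ _ _ (fun j => range (pr j)) (fun i x => x 0 i)) => //.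
- by exists (pr 0%N 0); exists 0.
- move=> j _ [x _ <-]; exists (pr j x) => //; apply/rowP => i; rewrite !mxE.
  by rewrite ltnS; case: (ltngtP i j).
- by move=> j g h Hg Hh; apply: polymap_range_prime.
- exact: polyfun_coord.
- by move=> j _ [x _ <-]; rewrite mxE ltnn.
- move=> j; exists (delta_mx 0 j); last by rewrite mxE !eqxx oner_eq0.
  exists (delta_mx 0 j) => //; apply/rowP => i; rewrite !mxE eqxx /=.
  by case: (eqVneq i j) => [->|]; rewrite ?ltnSn // if_same.
- by move=> x _; apply: HP.
Qed.

Definition mnm_of_ffun n b (a : {ffun 'I_n -> 'I_b}) : multinom n :=
  Multinom (mktuple (fun i => nat_of_ord (a i))).

Lemma mnm_of_ffunE n b (a : {ffun 'I_n -> 'I_b}) i : mnm_of_ffun a i = a i.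
Proof. exact: mnmE. Qed.

Lemma mnm_of_ffun_inj n b : injective (@mnm_of_ffun n b).
Proof.
by move=> a c /mnmP ac; apply/ffunP => i; apply/val_inj; have := ac i; rewrite !mnm_of_ffunE.
Qed.

Section DegreeBound.
Variables (K : comNzRingType) (m : nat).

Definition degle (p : mpoly m K) d := forall a, a \in msupp p -> (mdeg a <= d)%N.

Lemma degle1 : degle 1 0.
Proof. by move=> a; rewrite -mpolyC1 msupp1 inE => /eqP->; rewrite mdeg0. Qed.

Lemma degleM p q d e : degle p d -> degle q e -> degle (p * q) (d + e).
Proof.
move=> Hp Hq a /msuppM_le /allpairsP[[b c] /= [Pb Qc ->]].
by rewrite mdegD leq_add ?Hp ?Hq.
Qed.

Lemma degleX p d k : degle p d -> degle (p ^+ k) (d * k).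
Proof.
move=> Hp; elim: k => [|k IH]; first by rewrite muln0; apply: degle1.
by rewrite exprS mulnS; apply: degleM.
Qed.

Lemma degle_prod k (F : 'I_k -> mpoly m K) d :
  (forall i, degle (F i) d) -> degle (\prod_i F i) (d * k).
Proof.
move=> HF; elim: k F HF => [|k IH] F HF.
  by rewrite big_ord0 muln0; apply: degle1.
by rewrite big_ord_recl mulnS; apply: degleM => //; apply: IH => i; apply: HF.
Qed.

Lemma degle_leq p d e : (d <= e)%N -> degle p d -> degle p e.
Proof. by move=> de Hp a /Hp /leq_trans; apply. Qed.

End DegreeBound.

(** More polynomials than variables are algebraically dependent: the [d ^ k]
    monomials of exponents less than [d] in them lie in a space of dimension
    [(D * k * d).+1 ^ m], which is smaller once [d] is large. *)
Lemma alg_dependent (K : fieldType) m k (q : 'I_k -> mpoly m K) : (m < k)%N ->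
  exists2 P : mpoly k K, P != 0 &
    forall x, meval (fun j => meval x (q j)) P = 0.
Proof.
move=> ltmk; pose D := (\max_j mpoly.msize (q j))%N.
have HD j : degle (q j) D.
  move=> a /msize_mdeg_lt/ltnW/leq_trans; apply.
  by rewrite /D (bigD1 j) //= leq_maxl.
pose d := ((D * k).+1 ^ m).+1.
pose B := (D * d * k).+1.
pose A := {ffun 'I_k -> 'I_d}; pose C := {ffun 'I_m -> 'I_B}.
pose Q (a : A) := \prod_j q j ^+ a j.
have HQ a : degle (Q a) (D * d * k).
  apply: degle_prod => j; apply: degle_leq _ (degleX (HD j)).
  by rewrite leq_mul2l ltnW ?orbT.
have ltCA : (#|{: C}| < #|{: A}|)%N.
  rewrite !card_ffun !card_ord.
  have leB : (B <= (D * k).+1 * d)%N.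
    by rewrite /B -mulnA [(d * k)%N]mulnC mulnA mulSn -addn1 addnC leq_add2r.
  (* The choice of [d] makes it exceed the constant factor [(D * k).+1 ^ m]. *)
  apply: (@leq_ltn_trans (((D * k).+1 * d) ^ m)%N).
    by case: (m) => [|m']; rewrite ?expn0 // leq_exp2r.
  apply: (@leq_trans (d ^ m.+1)%N); last by rewrite leq_pexp2l.
  by rewrite expnMn expnS ltn_pmul2r ?expn_gt0.
pose M : 'M[K]_(#|{: A}|, #|{: C}|) :=
  \matrix_(i, j) mcoeff (mnm_of_ffun (enum_val j)) (Q (enum_val i)).
have : kermx M != 0.
  by rewrite kermx_eq0 /row_free neq_ltn (leq_ltn_trans (rank_leq_col _)).
case/rowV0Pn => v /sub_kermxP vM v0.
have [i0 vi0] : exists i, v 0 i != 0.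
  apply/existsP; apply: contraNT v0 => /existsPn v0; apply/eqP/rowP => i.
  by rewrite mxE; apply/eqP; have := v0 i; rewrite negbK.
exists (\sum_i v 0 i *: mpolyX K (mnm_of_ffun (enum_val i))).
  apply: contraNneq vi0 => /(congr1 (mcoeff (mnm_of_ffun (enum_val i0)))).
  rewrite raddf_sum mcoeff0 /= (bigD1 i0) //= big1 ?addr0.
    by rewrite mcoeffZ mcoeffX eqxx mulr1 => ->.
  move=> i ne_i; rewrite mcoeffZ mcoeffX (inj_eq (@mnm_of_ffun_inj _ _)).
  by rewrite (inj_eq enum_val_inj) (negPf ne_i) mulr0.
move=> x.
have Q0 : \sum_i v 0 i *: Q (enum_val i) = 0.
  apply/mpolyP => a; rewrite mcoeff0 raddf_sum /=.
  have [lta|/forallPn[j]] := boolP [forall j, (a j < B)%N]; last first.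
    rewrite -leqNgt => leBa; apply: big1 => i _; rewrite mcoeffZ.
    rewrite [mcoeff a _]memN_msupp_eq0 ?mulr0 //.
    apply/negP => /HQ; rewrite leqNgt => /negP; apply.
    by rewrite (leq_trans leBa) // mdegE (bigD1 j) //= leq_addr.
  pose c : C := [ffun j => Ordinal (forallP lta j)].
  have -> : a = mnm_of_ffun (enum_val (enum_rank c)).
    by rewrite enum_rankK; apply/mnmP => j; rewrite mnm_of_ffunE ffunE.
  move/rowP: vM => /(_ (enum_rank c)); rewrite !mxE => vM.
  by rewrite -[RHS]vM; apply: eq_bigr => i _; rewrite mcoeffZ mxE.
rewrite -[RHS](meval0 x) -Q0 !raddf_sum; apply: eq_bigr => i _ /=.
rewrite !mevalZ mevalX rmorph_prod /=; congr (_ * _); apply: eq_bigr => j _.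
by rewrite mnm_of_ffunE rmorphXn.
Qed.

(** * Closures of polynomial images *)

Section Zariski.
Variables (K : fieldType) (N : nat).
Implicit Types (S Z : set 'rV[K]_N) (f : 'rV[K]_N -> K).

Lemma zariski_closedP Z : zariski_closed Z <->
  forall x, (forall f, polyfun f -> (forall y, Z y -> f y = 0) -> f x = 0) -> Z x.
Proof.
split=> [[F ->] x H p Fp|H].
  by apply: (H (fun y => meval (rvec y) p)) => [|y]; [exists p | apply].
exists [set p | forall y, Z y -> meval (rvec y) p = 0].
apply/seteqP; split=> [x Zx p|x Hx]; first exact.
by apply: H => f [p Hp] fZ; rewrite Hp; apply: Hx => y Zy; rewrite /= -Hp fZ.
Qed.

Lemma zariski_closureP S x : zariski_closure S x <->
  forall f, polyfun f -> (forall y, S y -> f y = 0) -> f x = 0.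
Proof.
split=> [Sx f [p Hp] fS | H Z [/zariski_closedP closedZ SZ]].
  rewrite Hp; apply: (Sx [set y | forall g, g = p -> meval (rvec y) g = 0]) => //.
  split=> [|y Sy g ->]; last by rewrite -Hp fS.
  by exists [set p].
by apply: closedZ => f Hf fZ; apply: H => // y /SZ; apply: fZ.
Qed.

Lemma sub_zariski_closure S : S `<=` zariski_closure S.
Proof. by move=> x Sx; apply/zariski_closureP => f _; apply. Qed.

Lemma zariski_closure_closed S : zariski_closed (zariski_closure S).
Proof.
apply/zariski_closedP => x H; apply/zariski_closureP => f Hf fS.
by apply: H => // y /zariski_closureP; apply.
Qed.

Lemma zariski_closure_min S Z : zariski_closed Z -> S `<=` Z -> zariski_closure S `<=` Z.
Proof. by move=> closedZ SZ x; apply. Qed.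

Lemma zariski_closure_sub S T : S `<=` T -> zariski_closure S `<=` zariski_closure T.
Proof.
move=> ST; apply: zariski_closure_min; first exact: zariski_closure_closed.
exact: subset_trans (@sub_zariski_closure T).
Qed.

Lemma zariski_closedI_zero Z g : zariski_closed Z -> polyfun g ->
  zariski_closed (Z `&` [set x | g x = 0]).
Proof.
move=> /zariski_closedP closedZ Hg; apply/zariski_closedP => x H; split.
  by apply: closedZ => f Hf fZ; apply: H => // y [/fZ].
by apply: H => // y [].
Qed.

Lemma zariski_irreducible_prime Z g h : zariski_irreducible Z ->
  polyfun g -> polyfun h -> (forall x, Z x -> g x * h x = 0) ->
  (forall x, Z x -> g x = 0) \/ (forall x, Z x -> h x = 0).
Proof.
move=> [closedZ _ irrZ] Hg Hh gh0.
have : Z = (Z `&` [set x | g x = 0]) `|` (Z `&` [set x | h x = 0]).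
  apply/seteqP; split=> [x Zx|x [][]//].
  by have /eqP := gh0 x Zx; rewrite mulf_eq0 => /orP[] /eqP ?; [left | right].
case/(irrZ _ _ (zariski_closedI_zero closedZ Hg) (zariski_closedI_zero closedZ Hh)) => ZE.
  by left => x; rewrite ZE => -[].
by right => x; rewrite ZE => -[].
Qed.

Lemma zariski_closed_separate Z x : zariski_closed Z -> ~ Z x ->
  exists f, [/\ polyfun f, forall y, Z y -> f y = 0 & f x != 0].
Proof.
move=> /zariski_closedP closedZ nZx; apply: contra_notP nZx => /forallNP H.
apply: closedZ => f Hf fZ; apply/eqP/negPn/negP => fx.
by apply: (H f); split.
Qed.

(** Polynomials separating consecutive members of a chain are independent on the
    image, so there are at most as many as there are parameters. *)
Lemma zariski_chain_bound m (psi : 'rV[K]_m -> 'rV[K]_N) k c : polymap psi ->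
  zariski_chain (zariski_closure (range psi)) k c -> (k <= m)%N.
Proof.
move=> Hpsi [irr lt_c]; rewrite leqNgt; apply/negP => ltmk.
have sep (j : 'I_k) : exists f, [/\ polyfun f, forall y, c j y -> f y = 0 &
    exists2 x, c j.+1 x & f x != 0].
  have [sub /existsNP[x]] := lt_c j (ltn_ord j); rewrite not_implyE => -[cx ncx].
  have [[closedc _ _] _] := irr j (ltnW (ltn_ord j)).
  have [f [Hf fc fx]] := zariski_closed_separate closedc ncx.
  by exists f; split=> //; exists x.
have [f Hf] := choice sep.
have : forall j, exists p : mpoly m K, forall x, f j (psi x) = meval (rvec x) p.
  by move=> j; have [fj _ _] := Hf j; apply: polyfun_comp fj Hpsi.
case/choice => q Hq.
have [P /eqP P0 HP] := alg_dependent q ltmk; apply: P0.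
apply: (@chain_alg_indep _ _ _ c f).
- by have [[_ nonempty _] _] := irr 0%N (leq0n _).
- by move=> j; have [] := lt_c j (ltn_ord j).
- move=> j g h; apply: zariski_irreducible_prime.
  by have [] := irr j.+1 (ltn_ord j).
- by move=> j; have [] := Hf j.
- by move=> j; have [] := Hf j.
- by move=> j; have [] := Hf j.
move=> x ckx; have [_ /(_ _ ckx)] := irr k (leqnn k).
move/zariski_closureP/(_ (fun z => meval (fun j => f j z) P)); apply.
  by apply: polyfun_meval => j; have [] := Hf j.
by move=> _ [y _ <-]; rewrite -[RHS](HP (rvec y)); apply: meval_eq => j; rewrite Hq.
Qed.

End Zariski.

Lemma zariski_closure_range_irreducible (K : numFieldType) m N
    (psi : 'rV[K]_m -> 'rV[K]_N) :
  polymap psi -> zariski_irreducible (zariski_closure (range psi)).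
Proof.
move=> Hpsi; split; first exact: zariski_closure_closed.
  by exists (psi 0); apply: sub_zariski_closure; exists 0.
move=> A B closedA closedB EAB.
have [subA|nsubA] := pselect (range psi `<=` A).
  left; apply/seteqP; split; first exact: zariski_closure_min.
  by rewrite EAB => x; left.
have [subB|nsubB] := pselect (range psi `<=` B).
  right; apply/seteqP; split; first exact: zariski_closure_min.
  by rewrite EAB => x; right.
move/existsNP: nsubA => [x /not_implyP[rx nAx]].
move/existsNP: nsubB => [y /not_implyP[ry nBy]].
have [g [Hg gA gx]] := zariski_closed_separate closedA nAx.
have [h [Hh hB hy]] := zariski_closed_separate closedB nBy.
have gh0 z : range psi z -> g z * h z = 0.
  move/sub_zariski_closure; rewrite EAB => -[/gA->|/hB->]; first by rewrite mul0r.
  by rewrite mulr0.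
have [/(_ x rx)/eqP|/(_ y ry)/eqP] := polymap_range_prime Hpsi Hg Hh gh0.
  by rewrite (negPf gx).
by rewrite (negPf hy).
Qed.

(** * Chains through an immersion *)

(** The arguments of [P] agree to first order with the coordinates. So the
    coefficient of lowest order in [t] is the value at [b] of the lowest degree
    form [Pd] of [P]. *)
Lemma lowest_degree_indep (K : numFieldType) k (P : mpoly k K) :
  (forall b : 'rV[K]_k, exists r : 'I_k -> {poly K},
     forall t, meval (fun j => t * (b 0 j + t * (r j).[t])) P = 0) ->
  P = 0.
Proof.
move=> HP; apply/eqP; apply: contraT => P0.
have [a1 Pa1] : exists a, a \in msupp P.
  by move: P0; rewrite -msupp_eq0; case: (msupp P) => // a s _; exists a; rewrite inE eqxx.
have exd : exists d, has (fun a => mdeg a == d) (msupp P).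
  by exists (mdeg a1); apply/hasP; exists a1.
case: (ex_minnP exd) => d /hasP[a0 Pa0 /eqP da0] dmin.
have led a : a \in msupp P -> (d <= mdeg a)%N.
  by move=> Pa; apply: dmin; apply/hasP; exists a.
pose Pd := \sum_(a <- msupp P | mdeg a == d) mcoeff a P *: mpolyX K a.
have : Pd = 0.
  apply: mpoly_eval0 => b; have [r Hr] := HP b.
  pose S := \sum_(a <- msupp P) (mcoeff a P)%:P *
    ('X^(mdeg a - d) * \prod_j ((b 0 j)%:P + 'X * r j) ^+ a j).
  have S0 : 'X^d * S = 0.
    apply: poly_nat_roots => t; rewrite -[RHS](Hr t%:R) mevalE.
    rewrite /S mulr_sumr horner_sum big_seq [RHS]big_seq; apply: eq_bigr => a Pa.
    rewrite !hornerM hornerC !hornerXn horner_prod mulrCA; congr (_ * _).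
    rewrite mulrA -exprD subnKC ?led // mdegE -prodrXr -big_split /=.
    apply: eq_bigr => j _.
    by rewrite horner_exp hornerD hornerM hornerC hornerX exprMn.
  have {S0} S0 : S = 0.
    by apply/eqP; move/eqP: S0; rewrite mulf_eq0 expf_eq0 polyX_eq0 andbF.
  rewrite -[RHS](horner0 0) -S0 /S horner_sum /Pd raddf_sum /= big_mkcond.
  rewrite big_seq [RHS]big_seq; apply: eq_bigr => a Pa.
  rewrite !hornerM hornerC hornerXn horner_prod expr0n subn_eq0.
  have -> : (mdeg a <= d)%N = (mdeg a == d) by rewrite eqn_leq led // andbT.
  case: eqP => _; last by rewrite mul0r mulr0.
  rewrite mul1r mevalZ mevalX; congr (_ * _); apply: eq_bigr => j _.
  by rewrite horner_exp hornerD hornerM hornerC hornerX mul0r addr0.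
move/(congr1 (mcoeff a0)); rewrite mcoeff0 raddf_sum -big_filter /=.
rewrite (bigD1_seq a0) ?filter_uniq ?msupp_uniq //=; last by rewrite mem_filter da0 eqxx.
rewrite big1 ?addr0 => [|a ne_a]; last by rewrite mcoeffZ mcoeffX (negPf ne_a) mulr0.
by rewrite mcoeffZ mcoeffX eqxx mulr1 => /eqP; rewrite mcoeff_eq0 Pa0.
Qed.

Lemma polymap_affine (K : comNzRingType) m N (p : 'rV[K]_N) (M : 'M[K]_(m, N)) :
  polymap (fun x => p + x *m M).
Proof.
move=> j.
have H : polyfun (fun x : 'rV[K]_m => p 0 j + \sum_i x 0 i * M i j).
  apply: polyfunD; first exact: polyfun_const.
  by apply: polyfun_sum => i; apply: polyfunM; [apply: polyfun_coord|apply: polyfun_const].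
by apply: eq_polyfun H => x; rewrite !mxE.
Qed.

(** If the linear part of [psi] at [p] has left inverse [Lam], restricting [psi]
    to a flag of affine subspaces through [p] gives a chain of closures of images
    that is strict: on the image of the [i]-dimensional member any [i + 1]
    polynomials are dependent, whereas the first [i + 1] components of
    [psi *m Lam] agree to first order with the coordinates, and so are
    independent, on the next one. *)
Theorem zariski_chain_of_immersion (K : numFieldType) m N
    (psi : 'rV[K]_m -> 'rV[K]_N) (p : 'rV[K]_m) (Lam : 'M[K]_(N, m)) :
  polymap psi ->
  (forall (a : 'rV[K]_m) j, exists q : {poly K}, forall t,
     ((psi (p + t *: a) - psi p) *m Lam) 0 j = t * (a 0 j + t * q.[t])) ->
  exists c, zariski_chain (zariski_closure (range psi)) m c.
Proof.
move=> Hpsi Hlin.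
pose iota i (x : 'rV[K]_i) : 'rV[K]_m := p + x *m pid_mx i.
have Hiota i : polymap (psi \o @iota i).
  by apply: polymap_comp => //; apply: polymap_affine.
exists (fun i => zariski_closure (range (psi \o @iota i))); split=> [i lei|i lti].
  split; first exact: zariski_closure_range_irreducible.
  by apply: zariski_closure_sub => _ [x _ <-]; exists (iota i x).
split.
  apply: zariski_closure_sub => _ [x _ <-]; exists (x *m pid_mx i) => //=.
  congr (psi (_ + _)); rewrite -mulmxA mul_pid_mx; congr (_ *m pid_mx _).
  by rewrite (minn_idPl (leqnSn i)) (minn_idPr (leqnSn i)).
move=> sub.
pose g (j : 'I_i.+1) (y : 'rV[K]_N) := ((y - psi p) *m Lam) 0 (widen_ord lti j).
have Hg j : polyfun (g j).
  apply: eq_polyfun (polymap_affine (- (psi p *m Lam)) Lam (widen_ord lti j)) => y.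
  by rewrite /g mulmxBl addrC.
have : forall j, exists q : mpoly i K, forall x, g j (psi (iota i x)) = meval (rvec x) q.
  by move=> j; apply: polyfun_comp (Hg j) (Hiota i).
case/choice => q Hq.
have [P /eqP P0 HP] := alg_dependent q (ltnSn i); apply: P0.
have HPi x : range (psi \o @iota i.+1) x -> meval (fun j => g j x) P = 0.
  move/sub_zariski_closure/sub/zariski_closureP/(_ (fun z => meval (fun j => g j z) P)).
  apply; first exact: polyfun_meval.
  move=> _ [y _ <-]; rewrite -[RHS](HP (rvec y)).
  by apply: meval_eq => j; rewrite Hq.
apply: lowest_degree_indep => b.
have /choice[r Hr] := fun j : 'I_i.+1 => Hlin (b *m pid_mx i.+1) (widen_ord lti j).
exists r => t; rewrite -[RHS](HPi (psi (iota i.+1 (t *: b)))); last by exists (t *: b).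
apply: meval_eq => j; rewrite /g /iota -scalemxAl Hr; congr (_ * (_ + _)).
rewrite mxE (bigD1 j) //= big1 ?addr0; last first.
  by move=> l ne_l; rewrite mxE /= -val_eqE /= in ne_l *; rewrite (negPf ne_l) mulr0.
by rewrite mxE eqxx ltn_ord mulr1.
Qed.

Theorem zariski_dim_immersion (R : realType) (K : numFieldType) m N
    (psi : 'rV[K]_m -> 'rV[K]_N) (p : 'rV[K]_m) (Lam : 'M[K]_(N, m)) :
  polymap psi ->
  (forall (a : 'rV[K]_m) j, exists q : {poly K}, forall t,
     ((psi (p + t *: a) - psi p) *m Lam) 0 j = t * (a 0 j + t * q.[t])) ->
  zariski_dim R (zariski_closure (range psi)) = (m%:R)%:E.
Proof.
move=> Hpsi Hlin; apply/eqP; rewrite eq_le; apply/andP; split.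
  apply: ge_ereal_sup => _ [k [c Hc] <-]; rewrite lee_fin ler_nat.
  exact: zariski_chain_bound Hpsi Hc.
apply: ereal_sup_ubound; exists m => //.
exact: zariski_chain_of_immersion Hpsi Hlin.
Qed.

(** * The exponential of a real symmetric matrix *)

Section SpectralExponential.
Variables (R : realType) (n : nat).
Local Notation C := (complex R).
Local Notation rc := (real_complex R).

Lemma conj_diag_exp (K : fieldType) (P : 'M[K]_n) (z : 'rV[K]_n) k : P \in unitmx ->
  (invmx P *m diag_mx z *m P) ^+ k = invmx P *m diag_mx (map_mx (fun t => t ^+ k) z) *m P.
Proof.
move=> uP; elim: k => [|k IH].
  rewrite expr0 (_ : map_mx _ _ = const_mx 1); last by apply/rowP => i; rewrite !mxE.
  by rewrite diag_const_mx mulmx1 mulVmx.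
rewrite exprS IH -mulmxE -!mulmxA mulKVmx // [diag_mx z *m _]mulmxA mulmx_diag.
by congr (_ *m (diag_mx _ *m _)); apply/rowP => i; rewrite !mxE exprS.
Qed.

Lemma mx_cvg_entries (T : Type) (F : set_system T) m p
    (f : T -> 'M[R]_(m, p)) (M : 'M[R]_(m, p)) :
  Filter F -> (forall i j, (fun x => f x i j) @ F --> M i j) -> f @ F --> M.
Proof.
move=> FF Hf A [B HB sBA].
have near_B : F (fun x => forall ij : 'I_m * 'I_p, B ij.1 ij.2 (f x ij.1 ij.2)).
  apply: (@filter_forall _ _ (fun ij : 'I_m * 'I_p => [set x | B ij.1 ij.2 (f x ij.1 ij.2)])).
  by move=> [i j]; apply: (Hf i j); apply: HB.
suff : F (f @^-1` A) by [].
apply: (@filterS _ F FF _ _ _ near_B) => x Bx; apply: sBA.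
by move=> i j; have := Bx (i, j).
Qed.

Lemma conj_diag_entry (K : fieldType) (P : 'M[K]_n) (z : 'rV[K]_n) x y :
  (invmx P *m diag_mx z *m P) x y = \sum_i z 0 i * (invmx P x i * P i y).
Proof.
rewrite mxE; apply: eq_bigr => i _; rewrite mul_mx_diag mxE -mulrA.
by rewrite mulrCA.
Qed.

Lemma Re_sum I (r : seq I) (F : I -> C) :
  complex.Re (\sum_(i <- r) F i) = \sum_(i <- r) complex.Re (F i).
Proof. by apply: (big_morph (@complex.Re R)) => // -[a b] [c d]. Qed.

Lemma Im_sum I (r : seq I) (F : I -> C) :
  complex.Im (\sum_(i <- r) F i) = \sum_(i <- r) complex.Im (F i).
Proof. by apply: (big_morph (@complex.Im R)) => // -[a b] [c d]. Qed.

Lemma Re_mulrc (r : R) (z : C) : complex.Re (rc r * z) = r * complex.Re z.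
Proof. by case: z => a b /=; rewrite mul0r subr0. Qed.

Lemma Im_mulrc (r : R) (z : C) : complex.Im (rc r * z) = r * complex.Im z.
Proof. by case: z => a b /=; rewrite mul0r addr0. Qed.

(** A real matrix may be diagonalized by a complex [P] as long as its eigenvalues
    are real: the coefficients of the partial sums in the entries of [P] split
    into real and imaginary parts, which converge separately. *)
Lemma expmx_conj_diag (A : 'M[R]_n) (P : 'M[C]_n) (lam : 'rV[R]_n) : P \in unitmx ->
  map_mx rc A = invmx P *m diag_mx (map_mx rc lam) *m P ->
  map_mx rc (expmx A) = invmx P *m diag_mx (map_mx rc (map_mx expR lam)) *m P.
Proof.
move=> uP EA; pose q x y i := invmx P x i * P i y.
have Apow k x y : rc ((A ^+ k) x y) = \sum_i rc (lam 0 i ^+ k) * q x y i.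
  have := conj_diag_exp (map_mx rc lam) k uP; rewrite -EA.
  move/matrixP => /(_ x y); rewrite conj_diag_entry.
  have -> : map_mx rc A ^+ k = map_mx rc (A ^+ k).
    elim: k => [|k IH]; first by rewrite !expr0 map_mx1.
    by rewrite !exprS IH -!mulmxE map_mxM.
  rewrite mxE => ->; apply: eq_bigr => i _; rewrite !mxE.
  by rewrite -rmorphXn.
have ReA k x y : (A ^+ k) x y = \sum_i lam 0 i ^+ k * complex.Re (q x y i).
  have /(congr1 (@complex.Re R)) := Apow k x y.
  rewrite Re_sum => /= ->; apply: eq_bigr => i _; exact: Re_mulrc.
have ImA k x y : 0 = \sum_i lam 0 i ^+ k * complex.Im (q x y i).
  have /(congr1 (@complex.Im R)) := Apow k x y.
  rewrite Im_sum => /= E; rewrite [LHS]E; apply: eq_bigr => i _; exact: Im_mulrc.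
have cvgS (u : 'I_n -> R) : (fun N : nat => \sum_i series (exp_coeff (lam 0 i)) N * u i) @ \oo
    --> \sum_i expR (lam 0 i) * u i.
  apply: (cvg_big (op := +%R)) => [|i _]; first exact: add_continuous.
  apply: cvgMr_tmp; exact: is_cvg_series_exp_coeff.
have seriesE N (u : 'I_n -> R) : \sum_i series (exp_coeff (lam 0 i)) N * u i =
    \sum_(0 <= k < N) (k`!%:R)^-1 * \sum_i lam 0 i ^+ k * u i.
  rewrite /series /=; under [RHS]eq_bigr do rewrite mulr_sumr.
  rewrite [RHS]exchange_big /=. apply: eq_bigr => i _; rewrite mulr_suml.
  by apply: eq_bigr => k _; rewrite mulrA [_^-1 * _]mulrC.
have EexpA x y : expmx A x y = \sum_i expR (lam 0 i) * complex.Re (q x y i).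
  pose M := \matrix_(x, y) \sum_i expR (lam 0 i) * complex.Re (q x y i).
  have -> : expmx A = M.
    apply: cvg_lim; first exact: norm_hausdorff.
    apply: mx_cvg_entries => i j; rewrite mxE.
    rewrite (_ : (fun _ => _) = (fun N : nat =>
      \sum_l series (exp_coeff (lam 0 l)) N * complex.Re (q i j l))); first exact: cvgS.
    apply/funext => N; rewrite seriesE /series /= summxE; apply: eq_bigr => k _.
    by rewrite mxE ReA.
  by rewrite mxE.
have Im0 x y : \sum_i expR (lam 0 i) * complex.Im (q x y i) = 0.
  apply: (cvg_unique (@norm_hausdorff _ R^o) (cvgS _)).
  rewrite (_ : (fun _ => _) = fun=> 0); first exact: cvg_cst.
  apply/funext => N; rewrite seriesE; apply: big1 => k _.
  by rewrite -ImA mulr0.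
apply/matrixP => x y; rewrite conj_diag_entry mxE EexpA.
apply/eqP; rewrite eq_complex; apply/andP; split; apply/eqP.
  rewrite Re_sum; apply: eq_bigr => i _; rewrite !mxE; exact/esym/Re_mulrc.
rewrite Im_sum -[LHS](Im0 x y); apply: eq_bigr => i _; rewrite !mxE.
exact/esym/Im_mulrc.
Qed.

Lemma real_symmetric_diag (A : 'M[R]_n) : A^T = A ->
  exists (P : 'M[C]_n) (lam : 'rV[R]_n), P \in unitmx /\
    map_mx rc A = invmx P *m diag_mx (map_mx rc lam) *m P.
Proof.
move=> symA; pose Ac := map_mx rc A.
have realAc : Ac \is a mxOver Num.real.
  by apply/mxOverP => i j; rewrite mxE; apply/complex_realP; exists (A i j).
have symAc : Ac \is hermitianmx _ false idfun.
  by apply/is_hermitianmxP; rewrite expr0 scale1r map_mx_id // map_trmx symA.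
have hermAc := realsym_hermsym symAc realAc.
have realD := hermitian_spectral_diag_real hermAc.
have /orthomx_spectralP ED := hermitian_normalmx hermAc.
exists (spectralmx Ac), (map_mx (@complex.Re R) (spectral_diag Ac)).
split; first exact: spectral_unit.
have Elam : map_mx rc (map_mx (@complex.Re R) (spectral_diag Ac)) = spectral_diag Ac.
  apply/rowP => i; rewrite mxE [X in rc X]mxE.
  by have /complex_realP[r ->] := mxOverP realD 0 i.
by rewrite Elam; exact: ED.
Qed.

End SpectralExponential.

(** * Polynomials vanishing at exponentials *)

Definition matpoly (K : pzRingType) n d (c : 'rV[K]_d) (X : 'M[K]_n) : 'M[K]_n :=
  \sum_(k < d) c 0 k *: X ^+ k.

Lemma interpolation (K : fieldType) (I : eqType) (x y : I -> K) (s : seq I) :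
  (forall i j, x i = x j -> y i = y j) ->
  exists p : {poly K}, forall i, i \in s -> p.[x i] = y i.
Proof.
move=> xy; elim: s => [|i s [p Hp]]; first by exists 0.
have [/mapP[j js xij]|nis] := boolP (x i \in [seq x j | j <- s]).
  exists p => l; rewrite inE => /orP[/eqP->|/Hp//].
  by rewrite xij Hp // (xy _ _ xij).
pose w := \prod_(j <- s) ('X - (x j)%:P).
have wi : w.[x i] != 0.
  rewrite /w horner_prod prodf_seq_neq0; apply/allP => j js.
  rewrite hornerXsubC subr_eq0 /=; apply: contra nis => /eqP->.
  exact: map_f.
exists (p + ((y i - p.[x i]) / w.[x i]) *: w) => l; rewrite hornerD hornerZ inE.
move=> /orP[/eqP->|ls]; first by rewrite divfK // addrC subrK.
rewrite Hp //; suff -> : w.[x l] = 0 by rewrite mulr0 addr0.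
rewrite /w horner_prod; apply/eqP; rewrite prodf_seq_eq0; apply/hasP; exists l => //.
by rewrite /= hornerXsubC subrr.
Qed.

Lemma horner_mx_matpoly (K : fieldType) n (X : 'M[K]_n.+1) (p : {poly K}) d :
  (size p <= d)%N -> horner_mx X p = matpoly (\row_(k < d) p`_k) X.
Proof.
move=> sp; rewrite -{1}[p]coefK poly_def raddf_sum /matpoly.
under [RHS]eq_bigr do rewrite mxE.
rewrite -(big_mkord xpredT (fun k => horner_mx X (p`_k *: 'X^k))).
rewrite -[RHS](big_mkord xpredT (fun k => p`_k *: X ^+ k)).
rewrite [RHS](@big_cat_nat _ _ _ (size p)) //= [X in _ + X]big1_seq ?addr0.
  by apply: eq_bigr => k _; rewrite linearZ /= rmorphXn /= horner_mx_X.
by move=> k; rewrite mem_index_iota => /andP[_ /andP[lek _]]; rewrite nth_default ?scale0r.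
Qed.

Lemma horner_mx_conj_diag (K : fieldType) n (P : 'M[K]_n.+1) z (p : {poly K}) :
  P \in unitmx -> horner_mx (invmx P *m diag_mx z *m P) p =
  invmx P *m diag_mx (map_mx (horner p) z) *m P.
Proof. by move=> uP; rewrite horner_mx_uconjC // horner_mx_diag. Qed.

Lemma horner_mx_reduce (K : fieldType) n (X : 'M[K]_n.+1) (p : {poly K}) :
  exists c : 'rV[K]_n.+1, horner_mx X p = matpoly c X.
Proof.
exists (\row_(k < n.+1) (p %% char_poly X)`_k); rewrite -horner_mx_matpoly.
  by rewrite {1}(divp_eq p (char_poly X)) rmorphD rmorphM /= Cayley_Hamilton mulr0 add0r.
by rewrite -ltnS -(size_char_poly X) ltn_modp -size_poly_eq0 size_char_poly.
Qed.

Lemma expmx_matpoly (R : realType) n (A : 'M[R]_n.+1) : A^T = A ->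
  exists c : 'rV[complex R]_n.+1,
    map_mx (real_complex R) (expmx A) = matpoly c (map_mx (real_complex R) A).
Proof.
move=> /real_symmetric_diag [P [lam [uP EA]]].
have [p Hp] := @interpolation _ 'I_n.+1 (fun i => real_complex R (lam 0 i))
  (fun i => real_complex R (expR (lam 0 i))) (enum 'I_n.+1)
  (fun i j e => congr1 (fun t => real_complex R (expR t)) (complexI e)).
have [c Hc] := horner_mx_reduce (map_mx (real_complex R) A) p.
exists c; apply: etrans (expmx_conj_diag uP EA) _.
have Elam : map_mx (horner p) (map_mx (real_complex R) lam) =
    map_mx (real_complex R) (map_mx expR lam).
  by apply/rowP => i; rewrite !mxE Hp // mem_enum.
by rewrite -Elam -horner_mx_conj_diag // -EA.
Qed.

(** Apply the relation to the polynomial vanishing at all [y b] but one. *)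
Lemma power_sums_indep (K : fieldType) (I : eqType) (s : seq I) (c y : I -> K) :
  uniq s -> {in s &, injective y} ->
  (forall k, \sum_(a <- s) c a * y a ^+ k = 0) -> {in s, forall a, c a = 0}.
Proof.
move=> us yinj H a as_.
have Hp (p : {poly K}) : \sum_(b <- s) c b * p.[y b] = 0.
  under eq_bigr do rewrite horner_coef mulr_sumr.
  rewrite exchange_big big1 //= => k _.
  rewrite -[RHS](mulr0 p`_k) -[X in _ = _ * X](H k) mulr_sumr; apply: eq_bigr => b _.
  by rewrite mulrCA.
have := Hp (\prod_(b <- s | b != a) ('X - (y b)%:P)).
rewrite (bigD1_seq a) //= [X in _ + X]big1_seq ?addr0.
  move/eqP; rewrite mulf_eq0 => /orP[/eqP//|].
  rewrite horner_prod prodf_seq_eq0 => /hasP[b bs] /=.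
  rewrite hornerXsubC subr_eq0 => /andP[ba /eqP /(yinj _ _ as_ bs) ab].
  by rewrite ab eqxx in ba.
move=> b /andP[ba bs]; rewrite horner_prod; apply/eqP; rewrite mulf_eq0.
apply/orP; right; rewrite prodf_seq_eq0; apply/hasP; exists b => //=.
by rewrite ba hornerXsubC subrr eqxx.
Qed.

(** A truncated form of linear independence over the rationals: a polynomial of
    degree less than [d] in the exponentials of the [x i] sees no more of it. *)
Definition separated (V : nmodType) n d (x : 'rV[V]_n) : Prop :=
  forall a b : {ffun 'I_n -> 'I_d},
    \sum_i x 0 i *+ a i = \sum_i x 0 i *+ b i -> a = b.

(** At the [k]-th point the monomial of exponent [a] takes the [k]-th power of the
    exponential of [\sum_i lam 0 i *+ a i], and these bases are distinct. *)
Lemma mpoly_vanish_exp (R : realType) n d (H : mpoly n (complex R)) (lam : 'rV[R]_n) :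
  separated d lam -> (forall a, a \in msupp H -> (mdeg a < d)%N) ->
  (forall k : nat, meval (fun i => real_complex R (expR (k%:R * lam 0 i))) H = 0) ->
  H = 0.
Proof.
move=> sep degH H0; apply/mpolyP => a; rewrite mcoeff0.
have [aH|/memN_msupp_eq0//] := boolP (a \in msupp H).
pose y (a : multinom n) := real_complex R (expR (\sum_i lam 0 i *+ a i)).
apply: (@power_sums_indep _ _ (msupp H) (fun a => mcoeff a H) y) => //.
  move=> b c bH cH /complexI /expR_inj bc.
  have lt_d (b' : multinom n) i : b' \in msupp H -> (b' i < d)%N.
    move=> /degH; apply: leq_ltn_trans.
    by rewrite mdegE (bigD1 i) //= leq_addr.
  pose B := [ffun i => Ordinal (lt_d b i bH)].
  pose D := [ffun i => Ordinal (lt_d c i cH)].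
  have : B = D.
    apply: sep; transitivity (\sum_i lam 0 i *+ b i).
      by apply: eq_bigr => i _; rewrite ffunE.
    by rewrite bc; apply: eq_bigr => i _; rewrite ffunE.
  move=> /ffunP BD; apply/mnmP => i; have := congr1 val (BD i).
  by rewrite !ffunE.
move=> k; rewrite -[RHS](H0 k) mevalE; apply: eq_bigr => b _; congr (_ * _).
rewrite /y -rmorphXn /= -expRM_natl mulr_sumr expR_sum rmorph_prod /=.
apply: eq_bigr => i _; rewrite -rmorphXn /= -expRM_natl mulrnAr.
by rewrite [X in _ = _ (expR X)]mulr_natl.
Qed.

Lemma mpoly_linear_subst (K : comNzRingType) m N (F : mpoly N K) (M : 'M[K]_(m, N)) :
  exists2 H : mpoly m K, forall a, a \in msupp H -> (mdeg a <= mpoly.msize F)%N &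
    forall z, meval (rvec z) H = meval (rvec (z *m M)) F.
Proof.
pose l j : mpoly m K := \sum_i M i j *: mpolyX K (mnm1 i).
have degl j : degle (l j) 1.
  move=> a /msupp_sum_le; rewrite filter_predT => /flattenP[s /mapP[i _ ->]].
  by move/msuppZ_le; rewrite msuppX inE => /eqP->; rewrite mdeg1.
exists (\sum_(a <- msupp F) mcoeff a F *: \prod_j l j ^+ a j).
  move=> a /msupp_sum_le; rewrite filter_predT => /flattenP[s /mapP[b bF ->]].
  move/msuppZ_le => ab; apply: leq_trans (ltnW (msize_mdeg_lt bF)).
  have degp : degle (\prod_j l j ^+ b j) (mdeg b).
    rewrite mdegE; elim/big_rec2: _ => [|j q e _ Hq]; first exact: degle1.
    by apply: degleM => //; rewrite -[e in degle _ e]mul1n; apply: degleX.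
  exact: degp.
move=> z; rewrite raddf_sum /= mevalE; apply: eq_bigr => a _.
rewrite mevalZ rmorph_prod /=; congr (_ * _); apply: eq_bigr => j _.
rewrite rmorphXn /=; congr (_ ^+ _); rewrite raddf_sum /= /rvec mxE.
by apply: eq_bigr => i _; rewrite mevalZ mevalXU mulrC.
Qed.

(** On the matrices [invmx P *m diag_mx z *m P] the polynomial [F] becomes a
    polynomial in [z] of no larger degree, and [expmx (k%:R *: A)] is the matrix
    with [z i = exp (k * lam i)]; so [mpoly_vanish_exp] applies. *)
Lemma vanish_exp_multiples (R : realType) n d F (A : 'M[R]_n) (P : 'M[complex R]_n)
    (lam : 'rV[R]_n) : P \in unitmx ->
  map_mx (real_complex R) A = invmx P *m diag_mx (map_mx (real_complex R) lam) *m P ->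
  separated d lam -> (mpoly.msize F < d)%N ->
  (forall k : nat, meval (rvec (sym_coord (map_mx (real_complex R)
     (expmx (k%:R *: A))))) F = 0) ->
  forall z, meval (rvec (sym_coord (invmx P *m diag_mx z *m P))) F = 0.
Proof.
move=> uP EA sep degF F0 z.
pose M := \matrix_(i, k) (invmx P (@enum_val _ (upper_index n) k).1 i * P i (enum_val k).2).
have EM w : sym_coord (invmx P *m diag_mx w *m P) = w *m M.
  apply/rowP => k; rewrite mxE conj_diag_entry mxE; apply: eq_bigr => i _.
  by rewrite mxE.
have [H degH HF] := mpoly_linear_subst F M.
rewrite EM -HF (_ : H = 0) ?meval0 //.
apply: (mpoly_vanish_exp sep) => [a /degH/leq_ltn_trans|k]; first exact.
have EkA : map_mx (real_complex R) (k%:R *: A) =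
    invmx P *m diag_mx (map_mx (real_complex R) (k%:R *: lam)) *m P.
  by rewrite !map_mxZ EA /= linearZ /= -scalemxAr -scalemxAl.
rewrite -[RHS](F0 k) (expmx_conj_diag uP EkA) EM -HF; apply: meval_eq => i.
by rewrite /rvec !mxE.
Qed.

Definition polymx (K : comNzRingType) m n p (Phi : 'rV[K]_m -> 'M[K]_(n, p)) : Prop :=
  forall i j, polyfun (fun x => Phi x i j).

Section PolynomialMatrices.
Variables (K : comNzRingType) (m : nat).

Lemma polymx_cst n p (A : 'M[K]_(n, p)) : polymx (fun _ : 'rV[K]_m => A).
Proof. by move=> i j; apply: polyfun_const. Qed.

Lemma polymxD n p (Phi Psi : 'rV[K]_m -> 'M[K]_(n, p)) :
  polymx Phi -> polymx Psi -> polymx (fun x => Phi x + Psi x).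
Proof.
move=> HPhi HPsi i j; apply: eq_polyfun (polyfunD (HPhi i j) (HPsi i j)) => x.
by rewrite mxE.
Qed.

Lemma polymxZ n p g (Phi : 'rV[K]_m -> 'M[K]_(n, p)) :
  polyfun g -> polymx Phi -> polymx (fun x => g x *: Phi x).
Proof.
move=> Hg HPhi i j; apply: eq_polyfun (polyfunM Hg (HPhi i j)) => x.
by rewrite mxE.
Qed.

Lemma polymx_exp n (Phi : 'rV[K]_m -> 'M[K]_n) k :
  polymx Phi -> polymx (fun x => Phi x ^+ k).
Proof.
move=> HPhi; elim: k => [|k IH] i j.
  by apply: eq_polyfun (polyfun_const m ((1%:M : 'M[K]_n) i j)) => x; rewrite expr0.
have H : polyfun (fun x => \sum_l Phi x i l * (Phi x ^+ k) l j).
  by apply: polyfun_sum => l; apply: polyfunM.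
by apply: eq_polyfun H => x; rewrite exprS mxE.
Qed.

Lemma polymx_matpoly n d (c : 'rV[K]_m -> 'rV[K]_d) (Phi : 'rV[K]_m -> 'M[K]_n) :
  polymap c -> polymx Phi -> polymx (fun x => matpoly (c x) (Phi x)).
Proof.
move=> Hc HPhi i j.
have H : polyfun (fun x => \sum_(k < d) c x 0 k * (Phi x ^+ k) i j).
  by apply: polyfun_sum => k; apply: polyfunM => //; apply: polymx_exp.
apply: eq_polyfun H => x; rewrite /matpoly summxE.
by apply: eq_bigr => k _; rewrite mxE.
Qed.

Lemma polymap_sym_coord n (Phi : 'rV[K]_m -> 'M[K]_n) :
  polymx Phi -> polymap (fun x => sym_coord (Phi x)).
Proof.
move=> HPhi k; apply: eq_polyfun (HPhi (enum_val k).1 (enum_val k).2) => x.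
by rewrite mxE.
Qed.

End PolynomialMatrices.

Definition sep_mpoly (K : comNzRingType) n d : mpoly n K :=
  \prod_(ab : {ffun 'I_n -> 'I_d} * {ffun 'I_n -> 'I_d} | ab.1 != ab.2)
    \sum_i ((ab.1 i)%:R - (ab.2 i)%:R) *: mpolyX K (mnm1 i).

Lemma sep_mpolyP (K : idomainType) n d (x : 'rV[K]_n) :
  reflect (separated d x) (meval (rvec x) (sep_mpoly K n d) != 0).
Proof.
have E (a b : {ffun 'I_n -> 'I_d}) :
    meval (rvec x) (\sum_i ((a i)%:R - (b i)%:R) *: mpolyX K (mnm1 i)) =
    \sum_i x 0 i *+ a i - \sum_i x 0 i *+ b i.
  rewrite raddf_sum -sumrB /=; apply: eq_bigr => i _.
  by rewrite mevalZ mevalXU mulrBl !mulr_natl.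
rewrite rmorph_prod /=; apply: (iffP (prodf_neq0 _ _)) => [H a b ab|sep [a b] /= ab].
  apply/eqP; apply: contraT => nab; have := H (a, b) nab.
  by rewrite /= E ab subrr eqxx.
by rewrite E subr_eq0; apply: contra ab => /eqP/sep->.
Qed.

Lemma sep_mpoly_sym (K : comNzRingType) n d : sep_mpoly K n d \is symmetric.
Proof.
apply/issymP => s; rewrite /sep_mpoly rmorph_prod /=.
pose act (t : 'S_n) (a : {ffun 'I_n -> 'I_d}) := [ffun i => a (t i)].
have actK t : cancel (act t) (act t^-1%g).
  by move=> a; apply/ffunP => i; rewrite !ffunE permKV.
have act_inj t : injective (act t) := can_inj (actK t).
pose act2 ab := (act s^-1%g ab.1, act s^-1%g ab.2).
have act2_inj : injective act2 by move=> [a b] [c e] [/act_inj-> /act_inj->].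
rewrite [RHS](reindex_inj act2_inj) /=.
apply: eq_big => [[a b]|[a b] _] /=; first by rewrite (inj_eq (act_inj _)).
rewrite raddf_sum /= (reindex_inj (@perm_inj _ s^-1%g)) /=.
apply: eq_bigr => i _; rewrite !ffunE linearZ /=; congr (_ *: _).
by rewrite /msym mmapX mmap1U permKV.
Qed.

Lemma exists_separated (K : numFieldType) n d : exists x : 'rV[K]_n, separated d x.
Proof.
apply: contrapT => /forallNP H.
have : sep_mpoly K n d = 0.
  by apply: mpoly_eval0 => x; apply/eqP; apply: contra_notT (H x) => /sep_mpolyP.
move/eqP/prodf_eq0 => -[[a b] /= ab /eqP/mpolyP E].
case/eqP: ab; apply/ffunP => i; apply/val_inj/eqP.
move: (E (mnm1 i)); rewrite raddf_sum /= mcoeff0 (bigD1 i) //= big1 ?addr0.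
  rewrite mcoeffZ mcoeffX eqxx mulr1 => /eqP.
  by rewrite subr_eq0 eqr_nat.
move=> j ne_j; rewrite mcoeffZ mcoeffX (_ : (_ == _) = false) ?mulr0 //.
by apply: contraNF ne_j => /eqP/mnmP/(_ i); rewrite !mnm1E eqxx; case: eqP => // <-.
Qed.

Lemma separated_map (K L : fieldType) (h : {rmorphism K -> L}) n d (x : 'rV[K]_n) :
  separated d (map_mx h x) <-> separated d x.
Proof.
have E (a : {ffun 'I_n -> 'I_d}) :
    \sum_i map_mx h x 0 i *+ a i = h (\sum_i x 0 i *+ a i).
  by rewrite rmorph_sum; apply: eq_bigr => i _; rewrite mxE rmorphMn.
split=> sep a b ab; apply: sep; first by rewrite !E ab.
by apply: (fmorph_inj h); rewrite -!E.
Qed.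

Lemma char_poly_conj_diag (K : fieldType) n (P : 'M[K]_n) z : P \in unitmx ->
  char_poly (invmx P *m diag_mx z *m P) = \prod_i ('X - (z 0 i)%:P).
Proof.
move=> uP.
have -> : \prod_i ('X - (z 0 i)%:P) = char_poly (diag_mx z).
  rewrite char_poly_trig ?diag_mx_is_trig //.
  by apply: eq_bigr => i _; rewrite mxE eqxx mulr1n.
have polyP1 : map_mx polyC (invmx P) *m map_mx polyC P = 1%:M.
  by rewrite -map_mxM mulVmx // map_mx1.
rewrite /char_poly.
have -> : char_poly_mx (invmx P *m diag_mx z *m P) =
    map_mx polyC (invmx P) *m char_poly_mx (diag_mx z) *m map_mx polyC P.
  rewrite /char_poly_mx mulmxBr mulmxBl !map_mxM; congr (_ - _).
  by rewrite mul_mx_scalar -scalemxAl polyP1 scalemx1.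
by rewrite !det_mulmx mulrAC -det_mulmx polyP1 det1 mul1r.
Qed.

(** The product of all differences of sums of eigenvalues is symmetric in the
    eigenvalues, hence a polynomial in the coefficients of the characteristic
    polynomial; along a line of matrices it is a polynomial in the parameter. *)
Lemma separating_poly (K : fieldType) n d (D A : 'M[K]_n) :
  exists F : {poly K}, forall s P lam, P \in unitmx ->
    (1 - s) *: D + s *: A = invmx P *m diag_mx lam *m P ->
    F.[s] = meval (rvec lam) (sep_mpoly K n d).
Proof.
have [T [ET _]] := sym_fundamental (sep_mpoly_sym K n d).
pose X : 'M[{poly K}]_n := (1 - 'X) *: map_mx polyC D + 'X *: map_mx polyC A.
exists (\sum_(a <- msupp T) (mcoeff a T)%:P *
  \prod_(i < n) ((-1) ^+ i.+1 * (char_poly X)`_(n - i.+1)) ^+ a i) => s P lam uP EP.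
have EX : map_poly (horner_eval s) (char_poly X) = \prod_i ('X - (lam 0 i)%:P).
  rewrite map_char_poly -(char_poly_conj_diag lam uP) -EP; congr char_poly.
  apply/matrixP => i j; rewrite !mxE /= /horner_eval.
  by rewrite !(hornerD, hornerM, hornerN, hornerC, hornerX).
rewrite -ET comp_mpoly_meval mevalE horner_sum; apply: eq_bigr => a _.
rewrite hornerM hornerC horner_prod; congr (_ * _); apply: eq_bigr => i _.
rewrite horner_exp; congr (_ ^+ _); rewrite tnth_mktuple hornerM.
rewrite -[X in _ * X]/(horner_eval s _) -coef_map EX.
pose cs := mktuple (fun j => lam 0 j).
have -> : (\prod_j ('X - (lam 0 j)%:P))`_(n - i.+1) =
    (-1) ^+ i.+1 * meval (tnth cs) (mesym n K i.+1).
  rewrite -(mroots_coeff cs (Ordinal (ltn_ord i : (i.+1 < n.+1)%N))) big_tuple.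
  by congr ((_ : {poly K})`_ _); apply: eq_bigr => j _; rewrite tnth_mktuple.
rewrite mulrA horner_exp hornerN hornerC.
rewrite -exprD addnn -muln2 exprM sqrr_sign mul1r; apply: meval_eq => j.
by rewrite tnth_mktuple.
Qed.

Section ExponentialIdeal.
Variables (R : realType) (n : nat).
Local Notation C := (complex R).
Local Notation rc := (real_complex R).

(** Where the eigenvalues are separated, [vanish_exp_multiples] applies. On the line
    from a diagonal matrix with separated entries to [A] this fails only at the
    zeros of a nonzero polynomial [S], so the vanishing extends to [A]. *)
Lemma vanish_on_matpoly (L : set 'M[R]_n.+1) (f : 'rV[C]_#|upper_index n.+1| -> C) :
  (forall A, L A -> A^T = A) ->
  (forall a b A B, L A -> L B -> L (a *: A + b *: B)) ->
  (forall d, L (diag_mx d)) ->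
  polyfun f ->
  (forall A, L A -> f (sym_coord (map_mx rc (expmx A))) = 0) ->
  forall A (c : 'rV[C]_n.+1), L A -> f (sym_coord (matpoly c (map_mx rc A))) = 0.
Proof.
move=> symL linL diagL [F HF] f0 A c LA.
pose d := (mpoly.msize F).+1.
have [delta sep_delta] := exists_separated R n.+1 d.
pose Xs (s : R) := (1 - s) *: diag_mx delta + s *: A.
have LX s : L (Xs s) by apply: linL.
have EXs s : map_mx rc (Xs s) =
    (1 - rc s) *: map_mx rc (diag_mx delta) + rc s *: map_mx rc A.
  by rewrite map_mxD !map_mxZ rmorphB rmorph1.
have [S HS] := separating_poly d (map_mx rc (diag_mx delta)) (map_mx rc A).
have S0 : S != 0.
  have E0 : (1 - 0) *: map_mx rc (diag_mx delta) + 0 *: map_mx rc A =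
      invmx 1%:M *m diag_mx (map_mx rc delta) *m 1%:M.
    by rewrite subr0 scale1r scale0r addr0 invmx1 mul1mx mulmx1 map_diag_mx.
  have /sep_mpolyP := (separated_map rc d delta).2 sep_delta.
  by rewrite -(HS _ _ _ (unitmx1 _ _) E0); apply: contraNneq => ->; rewrite horner0.
have [G HG] : exists G : {poly C}, forall s : C,
    f (sym_coord (matpoly c
      ((1 - s) *: map_mx rc (diag_mx delta) + s *: map_mx rc A))) = G.[s].
  pose Phi (x : 'rV[C]_1) := (1 + (-1) * x 0 0) *: map_mx rc (diag_mx delta) +
    x 0 0 *: map_mx rc A.
  have HPhi : polymx Phi.
    apply: polymxD; apply: polymxZ; try exact: polymx_cst; last exact: polyfun_coord.
    apply: polyfunD; first exact: polyfun_const.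
    by apply: polyfunM; [exact: polyfun_const | exact: polyfun_coord].
  have Hf : polyfun (f \o (fun x => sym_coord (matpoly c (Phi x)))).
    apply: polyfun_comp; first by exists F.
    by apply: polymap_sym_coord; apply: polymx_matpoly => // k; apply: polyfun_const.
  have [G HG] := polyfun_line 0 (const_mx 1) Hf.
  by exists G => s; rewrite -HG /= /Phi !mxE add0r mulr1 mulN1r.
have G0 : S * G = 0.
  apply: poly_nat_roots => k; rewrite hornerM -HG.
  have [->|Sk] := eqVneq S.[k%:R] 0; first by rewrite mul0r.
  have Ek : (k%:R : C) = rc k%:R by rewrite rmorph_nat.
  rewrite Ek -EXs; have [P [lam [uP EP]]] := real_symmetric_diag (symL _ (LX k%:R)).
  rewrite (_ : f _ = 0) ?mulr0 //.
  have [p Hp] : exists p : {poly C},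
      matpoly c (map_mx rc (Xs k%:R)) = horner_mx (map_mx rc (Xs k%:R)) p.
    exists (\poly_(i < n.+1) c 0 (inord i)); rewrite (horner_mx_matpoly _ (size_poly _ _)).
    by congr matpoly; apply/rowP => i; rewrite mxE coef_poly ltn_ord inord_val.
  rewrite Hp EP horner_mx_conj_diag // HF.
  apply: (vanish_exp_multiples (d := d) uP EP) => // [|l].
    apply/(separated_map rc)/sep_mpolyP.
    by have := EP; rewrite EXs => /(HS _ _ _ uP) <-; rewrite -Ek.
  rewrite -HF; apply: f0; rewrite -[l%:R *: _]addr0 -(scale0r (Xs 0)).
  exact: linL.
have := HG 1; rewrite subrr scale0r add0r scale1r => ->.
by move/eqP: G0; rewrite mulf_eq0 (negPf S0) => /eqP->; rewrite horner0.
Qed.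

End ExponentialIdeal.

(** * Trees *)

Section Trees.
Variables (n : nat) (e : rel 'I_n).
Hypothesis tree_e : is_tree e.

Lemma tree_sym : ssrbool.symmetric e. Proof. by have [[]] := tree_e. Qed.

Lemma tree_irr x : e x x = false. Proof. by have [[_ ->]] := tree_e. Qed.

Lemma tree_neq x y : e x y -> x != y.
Proof. by move=> exy; apply: contraTneq exy => ->; rewrite tree_irr. Qed.

Lemma tree_acyclic c : ucycle e c -> (size c <= 2)%N.
Proof. by have [_ _ +] := tree_e; apply. Qed.

Lemma tree_no_triangle x y z : e x z -> e z y -> x != y -> ~~ e x y.
Proof.
move=> exz ezy ne_xy; apply/negP => exy.
suff /tree_acyclic : ucycle e [:: x; z; y] by [].
rewrite /ucycle /= exz ezy tree_sym exy !inE (negPf ne_xy) (negPf (tree_neq exz)).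
by rewrite (negPf (tree_neq ezy)).
Qed.

Lemma tree_unique_middle x y z w :
  e x z -> e z y -> e x w -> e w y -> x != y -> z = w.
Proof.
move=> exz ezy exw ewy ne_xy; apply/eqP; apply: contraT => ne_zw.
suff /tree_acyclic : ucycle e [:: x; z; y; w] by [].
rewrite /ucycle /= exz ezy tree_sym ewy tree_sym exw !inE (negPf ne_xy) (negPf ne_zw).
rewrite (negPf (tree_neq exz)) (negPf (tree_neq exw)) (negPf (tree_neq ezy)).
by rewrite eq_sym (negPf (tree_neq ewy)).
Qed.

Definition remove_edge (x y : 'I_n) : rel 'I_n :=
  [rel a b | e a b && ~~ ((a == x) && (b == y) || (a == y) && (b == x))].

Lemma remove_edge_sym x y : ssrbool.symmetric (remove_edge x y).
Proof.
move=> a b; rewrite /remove_edge /= tree_sym; congr (_ && ~~ _).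
by rewrite orbC [(b == x) && _]andbC [(b == y) && _]andbC.
Qed.

(** A path from [x] to [y] avoiding the edge would close up to a cycle with it. *)
Lemma tree_bridge x y : e x y -> ~~ connect (remove_edge x y) x y.
Proof.
move=> exy; apply/negP => /connectP[p0 /shortenP[p pathp uniqp _] Ey] {p0}.
suff /tree_acyclic : ucycle e (x :: p).
  case: p pathp uniqp Ey => [|z [|w p]] //=.
    by move=> _ _ Eyx; rewrite Eyx tree_irr in exy.
  by move=> + _ Eyz; rewrite Eyz /remove_edge /= !eqxx andbF.
rewrite /ucycle uniqp andbT /= rcons_path -Ey tree_sym exy andbT.
by apply: sub_path pathp => a b /andP[].
Qed.

Lemma tree_connect_ind (P : 'I_n -> Prop) u :
  P u -> (forall x y, e x y -> P x -> P y) -> forall x, P x.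
Proof.
move=> Pu step x; have [_ /(_ u x) /connectP[p pathp ->] _] := tree_e.
elim: p u Pu pathp => //= y p IH u Pu /andP[euy pathp].
by apply: IH => //; apply: step euy Pu.
Qed.

Definition edge_set : {set 'I_n * 'I_n} :=
  [set p : 'I_n * 'I_n | (p.1 < p.2)%N && e p.1 p.2].

(** The rank of the coboundary map: its kernel consists of the constants since the
    tree is connected, and it is onto since the indicator function of
    a component left by the removal of an edge is mapped to that edge. *)
Lemma card_edge_set : (0 < n)%N -> #|edge_set|.+1 = n.
Proof.
move=> n_gt0; pose ev := @enum_val _ (mem edge_set).
have ev_edge k : e (ev k).1 (ev k).2.
  by have := enum_valP k; rewrite inE => /andP[].
have ev_lt k : ((ev k).1 < (ev k).2)%N.
  by have := enum_valP k; rewrite inE => /andP[].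
pose M : 'M[rat]_(n, #|edge_set|) :=
  \matrix_(z, k) ((z == (ev k).1)%:R - (z == (ev k).2)%:R).
have mulM m (u : 'M[rat]_(m, n)) i k : (u *m M) i k = u i (ev k).1 - u i (ev k).2.
  rewrite mxE; under eq_bigr do rewrite mxE mulrBr.
  rewrite sumrB; congr (_ - _); [set z0 := (ev k).1 | set z0 := (ev k).2];
    by rewrite (bigD1 z0) //= eqxx mulr1 big1 ?addr0 // => z /negPf->; rewrite mulr0.
have rankM : \rank M = #|edge_set|.
  apply/eqP/row_fullP.
  exists (\matrix_(k, z) (connect (remove_edge (ev k).1 (ev k).2) (ev k).1 z)%:R).
  apply/matrixP => k l; rewrite mulM !mxE; have [<-|ne_kl] := eqVneq k l.
    by rewrite connect0 (negPf (tree_bridge (ev_edge k))) subr0.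
  apply/eqP; rewrite subr_eq0; apply/eqP; congr (nat_of_bool _)%:R.
  apply: same_connect_r; first exact: sym_connect_sym (remove_edge_sym _ _).
  apply: connect1; rewrite /remove_edge /= ev_edge /=; apply: contra ne_kl.
  move=> /orP[/andP[/eqP l1 /eqP l2]|/andP[/eqP l1 /eqP l2]].
    by rewrite -(inj_eq enum_val_inj) -/(ev k) -/(ev l) -pair_eqE /pair_eq /= l1 l2 !eqxx.
  by have := ev_lt l; rewrite l1 l2 ltnNge ltnW ?ev_lt.
have rank_ker : \rank (kermx M) = 1%N.
  pose ones : 'rV[rat]_n := const_mx 1.
  have const_ker : (ones <= kermx M)%MS.
    by apply/sub_kermxP/rowP => k; rewrite mulM !mxE subrr.
  have ker_const : (kermx M <= ones)%MS.
    apply/rV_subP => v /sub_kermxP vM; apply/sub_rVP.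
    exists (v 0 (Ordinal n_gt0)); apply/rowP => i; rewrite !mxE mulr1.
    apply: (tree_connect_ind (P := fun i => v 0 i = v 0 (Ordinal n_gt0))) i => //.
    suff step (x y : 'I_n) : (x < y)%N -> e x y -> v 0 x = v 0 y.
      move=> x y exy <-; case: (ltngtP x y) => [ltxy|ltyx|/val_inj Exy]; last by rewrite Exy.
        by rewrite -(step x y).
      by apply: step; rewrite // tree_sym.
    move=> ltxy exy; have xyE : (x, y) \in edge_set by rewrite inE ltxy exy.
    have := mulM 1%N v 0 (enum_rank_in xyE (x, y)).
    by rewrite vM mxE /ev enum_rankK_in //= => /esym/eqP; rewrite subr_eq0 => /eqP.
  apply/eqP; rewrite eqn_leq (leq_trans (mxrankS ker_const)) ?rank_leq_row //=.
  apply: leq_trans (mxrankS const_ker); rewrite lt0n mxrank_eq0.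
  by apply/negP => /eqP/rowP/(_ (Ordinal n_gt0)); rewrite !mxE => /eqP; rewrite oner_eq0.
have := mxrank_ker M; rewrite rankM rank_ker => nE.
have leEn : (#|edge_set| <= n)%N by rewrite -rankM rank_leq_row.
by rewrite -[RHS](subnK leEn) -nE add1n.
Qed.

Section Commutant.
Variables (K : fieldType) (A B : 'M[K]_n).
Hypotheses (symA : A^T = A) (symB : B^T = B).
Hypotheses (suppA : forall x y, x != y -> ~~ e x y -> A x y = 0)
           (suppB : forall x y, x != y -> ~~ e x y -> B x y = 0).
Hypothesis A_edge : forall x y, e x y -> A x y != 0.
Hypothesis AB : A *m B = B *m A.

Lemma mulmx_middle (X Y : 'M[K]_n) x y z :
  (forall x y, x != y -> ~~ e x y -> X x y = 0) ->
  (forall x y, x != y -> ~~ e x y -> Y x y = 0) ->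
  e x z -> e z y -> x != y -> (X *m Y) x y = X x z * Y z y.
Proof.
move=> suppX suppY exz ezy ne_xy; have nexy := tree_no_triangle exz ezy ne_xy.
rewrite mxE (bigD1 z) //= big1 ?addr0 // => w ne_wz.
have [->|ne_wx] := eqVneq w x; first by rewrite (suppY x y) ?mulr0.
have [->|ne_wy] := eqVneq w y; first by rewrite (suppX x y) ?mul0r.
have [exw|nexw] := boolP (e x w); last by rewrite suppX ?mul0r // eq_sym.
have [ewy|newy] := boolP (e w y); last by rewrite (suppY w y) ?mulr0.
by rewrite (tree_unique_middle exz ezy exw ewy ne_xy) eqxx in ne_wz.
Qed.

(** Comparing the entries of [A *m B] and [B *m A] at two vertices with a common
    neighbour shows that adjacent edges have the same ratio of entries of [B] and
    [A]; comparing them along an edge shows that the remaining diagonal part is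
    constant. *)
Lemma tree_commutant : (1 < n)%N -> exists alpha beta, B = alpha%:M + beta *: A.
Proof.
move=> n_gt1; pose r x y := B x y / A x y.
have BE x y : e x y -> B x y = r x y * A x y.
  by move=> exy; rewrite /r divfK ?A_edge.
have r_sym x y : r x y = r y x.
  by rewrite /r -{1}symB -{1}symA !mxE.
have r_adj x y z : e x z -> e z y -> r x z = r z y.
  move=> exz ezy; have [<-|ne_xy] := eqVneq x y; first exact: r_sym.
  have := congr1 (fun X : 'M[K]_n => X x y) AB.
  rewrite !(mulmx_middle (x := x) (y := y) (z := z)) //.
  rewrite (BE _ _ exz) (BE _ _ ezy) mulrCA -mulrA => /mulIf -> //.
  by rewrite mulf_neq0 ?A_edge.
pose u := Ordinal (ltnW n_gt1).
have [v euv] : exists v, e u v.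
  have [_ conn _] := tree_e; have /connectP[[|v p] /=] := conn u (Ordinal n_gt1).
    by move=> _ /(congr1 val).
  by case/andP => euv _ _; exists v.
have r_const x : forall y, e x y -> r x y = r u v.
  apply: (tree_connect_ind (P := fun x => forall y, e x y -> r x y = r u v) (u := u)) x.
    move=> y euy.
    by rewrite [RHS]r_sym; apply/esym/r_adj; rewrite // tree_sym.
  by move=> x y exy IH z eyz; rewrite -(IH y exy); apply/esym/r_adj.
pose D := B - r u v *: A.
have D_off x y : x != y -> D x y = 0.
  move=> ne_xy; rewrite !mxE; have [exy|nexy] := boolP (e x y).
    by rewrite (BE _ _ exy) (r_const _ _ exy) subrr.
  by rewrite suppA ?suppB // mulr0 subrr.
have AD : A *m D = D *m A.
  by rewrite /D mulmxBr mulmxBl AB -scalemxAl -scalemxAr.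
have AD_edge x y : e x y -> A x y * D y y = D x x * A x y.
  move=> exy; have := congr1 (fun X : 'M[K]_n => X x y) AD.
  rewrite [(A *m D) x y]mxE [(D *m A) x y]mxE (bigD1 y) //=.
  rewrite [X in _ + X]big1 ?addr0; last first.
    by move=> z ne_z; rewrite D_off ?mulr0.
  rewrite (bigD1 x) //= [X in _ + X]big1 ?addr0 // => z ne_z.
  by rewrite (D_off x z) ?mul0r // eq_sym.
have D_const x : D x x = D u u.
  apply: (tree_connect_ind (P := fun x => D x x = D u u) (u := u)) x => // x y exy <-.
  by apply/esym/(mulfI (A_edge exy)); rewrite (AD_edge _ _ exy) mulrC.
exists (D u u), (r u v); rewrite -[LHS](subrK (r u v *: A)) -/D; congr (_ + _).
apply/matrixP => x y; rewrite [RHS]mxE; have [<-|/D_off->//] := eqVneq x y.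
exact: D_const.
Qed.

End Commutant.

Lemma tree_edge : (1 < n)%N -> exists u v : 'I_n, (u < v)%N /\ e u v.
Proof.
move=> n_gt1; have := card_edge_set (ltnW n_gt1).
have [->|[[u v]]] := set_0Vmem edge_set; first by rewrite cards0 => E; rewrite -E in n_gt1.
by rewrite inE => /andP[ltuv euv]; exists u, v.
Qed.

End Trees.

(** Perturbing a diagonal matrix with distinct entries: the powers of
    [D + s *: A] applied to the all-ones row form a matrix whose determinant is
    polynomial in [s], and is a Vandermonde determinant at [s = 0]. *)
Lemma exists_powers_free (K : numFieldType) n (A : 'M[K]_n) (d : 'rV[K]_n) :
  (forall i j, d 0 i = d 0 j -> i = j) ->
  exists2 s : K, s != 0 & forall c : 'rV[K]_n,
    matpoly c (diag_mx d + s *: A) = 0 -> c = 0.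
Proof.
move=> d_inj; pose X : 'M[{poly K}]_n := map_mx polyC (diag_mx d) + 'X *: map_mx polyC A.
pose W : 'M[{poly K}]_n := \matrix_(k, j) \sum_i (X ^+ k) i j.
have mapX s : map_mx (horner_eval s) X = diag_mx d + s *: A.
  apply/matrixP => i j; rewrite !mxE /= /horner_eval.
  by rewrite hornerD hornerM hornerX !hornerC.
have mapXk s k : map_mx (horner_eval s) (X ^+ k) = (diag_mx d + s *: A) ^+ k.
  elim: k => [|k IH]; first by rewrite !expr0 map_mx1.
  by rewrite !exprS -!mulmxE map_mxM IH mapX.
have detW s : (\det W).[s] = \det (\matrix_(k, j) \sum_i ((diag_mx d + s *: A) ^+ k) i j).
  rewrite -[LHS]/(horner_eval s _) -det_map_mx; congr (\det _); apply/matrixP => k j.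
  rewrite !mxE raddf_sum; apply: eq_bigr => i _.
  by rewrite -mapXk [RHS]mxE.
have detW0 : (\det W).[0] != 0.
  rewrite detW scale0r addr0.
  have -> : \matrix_(k, j) (\sum_i (diag_mx d ^+ k) i j) = Vandermonde n d.
    apply/matrixP => k j; rewrite !mxE.
    have -> : diag_mx d ^+ k = diag_mx (\row_i d 0 i ^+ k).
      elim: (nat_of_ord k) => [|l IH].
        rewrite expr0 -[LHS]/(1%:M) -diag_const_mx; congr diag_mx.
        by apply/rowP => i; rewrite !mxE.
      rewrite exprS IH -mulmxE mulmx_diag; congr diag_mx.
      by apply/rowP => i; rewrite !mxE exprS.
    rewrite (bigD1 j) //= !mxE eqxx mulr1n big1 ?addr0 // => i ne_i.
    by rewrite mxE (negPf ne_i).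
  rewrite det_Vandermonde; apply/prodf_neq0 => i _; apply/prodf_neq0 => j ltij.
  by rewrite subr_eq0; apply: contraTneq ltij => /d_inj->; rewrite ltnn.
have [k /eqP] : exists k : nat, ('X * \det W).[k%:R] <> 0.
  apply/existsNP => /poly_nat_roots /eqP; rewrite mulf_eq0 polyX_eq0 /=.
  by apply/negP; apply: contraNneq detW0 => ->; rewrite horner0.
rewrite hornerM hornerX mulf_eq0 negb_or => /andP[k0 detWk]; exists k%:R => // c c0.
rewrite detW in detWk; set W' := (X in \det X) in detWk.
have uW : W' \in unitmx by rewrite unitmxE unitfE.
suff cW : c *m W' = 0 by rewrite -(mulmxK uW c) cW mul0mx.
apply/rowP => j; rewrite !mxE; under eq_bigr do rewrite mxE mulr_sumr.
rewrite exchange_big /=; transitivity (\sum_i matpoly c (diag_mx d + k%:R *: A) i j).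
  by apply: eq_bigr => i _; rewrite summxE; apply: eq_bigr => l _; rewrite mxE.
by rewrite c0; apply: big1 => i _; rewrite mxE.
Qed.

Lemma rV_linear_mx (K : comNzRingType) m N (f : 'rV[K]_m -> 'rV[K]_N) :
  (forall a x y, f (a *: x + y) = a *: f x + f y) -> exists J, forall x, f x = x *m J.
Proof.
move=> linf.
have f0 : f 0 = 0.
  by have := linf (-1) 0 0; rewrite scaler0 addr0 scaleN1r addNr.
have fD : {morph f : x y / x + y} by move=> x y; rewrite -[x]scale1r linf !scale1r.
exists (\matrix_i f (delta_mx 0 i)) => x.
rewrite {1}[x]row_sum_delta (big_morph f fD f0) mulmx_sum_row.
apply: eq_bigr => i _; rewrite rowK -[x 0 i *: delta_mx 0 i]addr0 linf f0.
by rewrite addr0.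
Qed.

Lemma poly_value0 (K : fieldType) (q : {poly K}) a : q.[0] = a ->
  exists r : {poly K}, forall t, q.[t] = a + t * r.[t].
Proof.
move=> q0; have /factor_theorem[r Er] : root (q - a%:P) 0.
  by rewrite /root hornerD hornerN hornerC q0 subrr.
exists r => t; move/(congr1 (horner^~ t)): Er.
rewrite subr0 hornerM hornerX hornerD hornerN hornerC [_ * t]mulrC => <-.
by rewrite addrC subrK.
Qed.

Lemma matpoly_in_affine (K : fieldType) n d (c : 'rV[K]_d) (Y : 'M[K]_n.+1) alpha beta :
  exists c' : 'rV[K]_n.+1, matpoly c (alpha%:M + beta *: Y) = matpoly c' Y.
Proof.
have [c' Hc'] := horner_mx_reduce Y (\sum_(k < d) c 0 k *: (alpha%:P + beta *: 'X) ^+ k).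
exists c'; rewrite -Hc' raddf_sum; apply: eq_bigr => k _ /=.
by rewrite !horner_mxZ rmorphXn /= rmorphD /= horner_mxZ horner_mx_C horner_mx_X.
Qed.

(** * Matrices supported on a graph *)

Definition graph_supported (K : nmodType) n (e : rel 'I_n) (A : 'M[K]_n) : Prop :=
  A^T = A /\ forall i j, i != j -> ~~ e i j -> A i j = 0.

Section GraphParametrization.
Variables (n : nat) (e : rel 'I_n) (u v : 'I_n).
Hypotheses (sym_e : ssrbool.symmetric e) (ltuv : (u < v)%N) (euv : e u v).

(** The free entries of a matrix supported on the graph whose entries at
    [(u, u)] and [(u, v)] are prescribed. *)
Definition free_entries : {set 'I_n * 'I_n} :=
  [set p : 'I_n * 'I_n | (p.1 <= p.2)%N && ((p.1 == p.2) || e p.1 p.2)]%SET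
    :\ (u, u) :\ (u, v).

Lemma mem_free_entries p : (p \in free_entries) =
  [&& p != (u, v), p != (u, u), (p.1 <= p.2)%N & (p.1 == p.2) || e p.1 p.2].
Proof. by rewrite !in_setD1 inE. Qed.

Lemma card_free_entries : (#|free_entries| + 2 = n + #|edge_set e|)%N.
Proof.
pose S : {set 'I_n * 'I_n} :=
    [set p : 'I_n * 'I_n | (p.1 <= p.2)%N && ((p.1 == p.2) || e p.1 p.2)]%SET.
have ne_uv : u != v by rewrite -val_eqE /= neq_ltn ltuv.
have Suu : (u, u) \in S by rewrite inE /= leqnn eqxx.
have Suv : (u, v) \in S :\ (u, u).
  by rewrite !inE /= euv orbT (ltnW ltuv) xpair_eqE eqxx eq_sym ne_uv.
have -> : (#|free_entries| + 2 = #|S|)%N.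
  by rewrite (cardsD1 (u, u) S) Suu (cardsD1 (u, v) (S :\ (u, u))) Suv addnC.
pose diag (i : 'I_n) := (i, i).
have -> : S = [set diag i | i in 'I_n]%SET :|: edge_set e.
  apply/setP => -[i j]; rewrite !inE /=.
  have -> : ((i, j) \in [set diag i | i in 'I_n]%SET) = (i == j).
    by apply/imsetP/eqP => [[k _ [-> ->]] | ->] //; exists j.
  case: eqVneq => [->|ne_ij]; first by rewrite leqnn.
  by rewrite /= leq_eqVlt val_eqE (negPf ne_ij).
rewrite cardsU disjoint_setI0 ?cards0 ?subn0.
  by rewrite card_imset ?card_ord // => i j [].
rewrite -setI_eq0; apply/eqP/setP => -[i j]; rewrite !inE /=.
by apply/negP => /andP[/imsetP[k _ [-> ->]]]; rewrite ltnn.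
Qed.

Variable K : comNzRingType.

Definition free_value (b : 'rV[K]_#|free_entries|) (p : 'I_n * 'I_n) : K :=
  \sum_s b 0 s *+ (enum_val s == p).

Definition free_mx (b : 'rV[K]_#|free_entries|) : 'M[K]_n :=
  \matrix_(i, j) if (i <= j)%N then free_value b (i, j) else free_value b (j, i).

Definition edge_mx : 'M[K]_n := delta_mx u v + delta_mx v u.

Lemma free_value_in b p (Sp : p \in free_entries) :
  free_value b p = b 0 (enum_rank_in Sp p).
Proof.
rewrite /free_value (bigD1 (enum_rank_in Sp p)) //= enum_rankK_in // eqxx mulr1n.
rewrite big1 ?addr0 // => s ne_s; case: eqP => [Es|]; last by rewrite mulr0n.
by case/eqP: ne_s; apply: enum_val_inj; rewrite enum_rankK_in.
Qed.

Lemma free_value_out b p : p \notin free_entries -> free_value b p = 0.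
Proof.
move=> Sp; apply: big1 => s _; case: eqP => [Es|]; last by rewrite mulr0n.
by have := enum_valP s; rewrite Es (negPf Sp).
Qed.

Lemma free_value_linear a x y p :
  free_value (a *: x + y) p = a * free_value x p + free_value y p.
Proof.
rewrite /free_value mulr_sumr -big_split; apply: eq_bigr => s _ /=.
by rewrite !mxE mulrnDl mulrnAr.
Qed.

Lemma free_mx_linear a x y : free_mx (a *: x + y) = a *: free_mx x + free_mx y.
Proof. by apply/matrixP => i j; rewrite !mxE; case: ifP; rewrite free_value_linear. Qed.

Lemma free_mx_supported b : graph_supported e (free_mx b).
Proof.
split=> [|i j ne_ij neij].
  by apply/matrixP => i j; rewrite !mxE; case: (ltngtP i j) => // /val_inj->.
rewrite mxE; case: ifP => _; apply: free_value_out; rewrite mem_free_entries /=.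
  by rewrite (negPf ne_ij) (negPf neij) !andbF.
by rewrite [j == i]eq_sym (negPf ne_ij) sym_e (negPf neij) !andbF.
Qed.

Lemma edge_mx_supported : graph_supported e edge_mx.
Proof.
split=> [|i j ne_ij neij]; first by rewrite linearD /= !trmx_delta addrC.
rewrite !mxE; case: (eqVneq i u) neij => [->|_]; case: (eqVneq j v) => [->|_] //=.
- by rewrite euv.
- by case: (eqVneq u v) => [Euv|]; [have := ltuv; rewrite Euv ltnn | rewrite addr0].
- by case: (eqVneq v u) => [Euv|]; [have := ltuv; rewrite Euv ltnn | rewrite andbF addr0].
case: (eqVneq i v) => [->|_]; case: (eqVneq j u) => [->|_]; rewrite ?addr0 //.
by rewrite sym_e euv.
Qed.

Lemma edge_mx_uu : edge_mx u u = 0.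
Proof. by rewrite !mxE eqxx /= -val_eqE /= (ltn_eqF ltuv) addr0. Qed.

Lemma edge_mx_uv : edge_mx u v = 1.
Proof. by rewrite !mxE !eqxx -val_eqE /= (ltn_eqF ltuv) addr0. Qed.

Lemma free_mx_uu b : free_mx b u u = 0.
Proof. by rewrite mxE leqnn free_value_out // mem_free_entries eqxx andbF. Qed.

Lemma free_mx_uv b : free_mx b u v = 0.
Proof. by rewrite mxE ltnW // free_value_out // mem_free_entries eqxx. Qed.

Lemma free_mx_inj b : free_mx b = 0 -> b = 0.
Proof.
move=> b0; apply/rowP => s; rewrite [RHS]mxE.
have Ss := enum_valP s; have := congr1 (fun X : 'M[K]_n => X (enum_val s).1 (enum_val s).2) b0.
rewrite !mxE; have -> : ((enum_val s).1 <= (enum_val s).2)%N.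
  by move: Ss; rewrite mem_free_entries => /and4P[].
by rewrite -surjective_pairing (free_value_in _ Ss) enum_valK_in.
Qed.

Lemma free_mx_surj B : graph_supported e B -> B u u = 0 -> B u v = 0 ->
  exists b, B = free_mx b.
Proof.
move=> [symB suppB] Buu Buv.
pose b := \row_s B (@enum_val _ free_entries s).1 (enum_val s).2; exists b.
suff upper (i j : 'I_n) : (i <= j)%N -> B i j = free_value b (i, j).
  apply/matrixP => i j; rewrite mxE; case: (leqP i j) => [/upper//|/ltnW/upper <-].
  by rewrite -{1}symB mxE.
move=> leij; have [Sij|] := boolP ((i, j) \in free_entries).
  by rewrite (free_value_in _ Sij) mxE enum_rankK_in.
move=> nSij; rewrite free_value_out //; move: nSij; rewrite mem_free_entries leij /=.
case: eqVneq => [[-> ->]//|_]; case: eqVneq => [[-> ->]//|_] /=.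
by rewrite negb_or => /andP[ne_ij /suppB]; apply.
Qed.

End GraphParametrization.

Lemma polymx_free_mx (K : comNzRingType) m n (e : rel 'I_n) u v
    (b : 'rV[K]_m -> 'rV[K]_#|free_entries e u v|) :
  polymap b -> polymx (fun x => free_mx (b x)).
Proof.
move=> Hb i j.
have H p : polyfun (fun x => free_value (b x) p).
  apply: polyfun_sum => s; rewrite /=; case: eqP => _.
    by apply: eq_polyfun (Hb s) => x; rewrite mulr1n.
  by apply: eq_polyfun (polyfun_const m 0) => x; rewrite mulr0n.
have [leij|ltji] := leqP i j.
  by apply: eq_polyfun (H (i, j)) => x; rewrite mxE leij.
by apply: eq_polyfun (H (j, i)) => x; rewrite mxE leqNgt ltji.
Qed.

Lemma map_free_mx (K L : comNzRingType) (h : {rmorphism K -> L}) n (e : rel 'I_n) u v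
    (b : 'rV[K]_#|free_entries e u v|) :
  map_mx h (free_mx b) = free_mx (map_mx h b).
Proof.
have E p : h (free_value b p) = free_value (map_mx h b) p.
  by rewrite rmorph_sum; apply: eq_bigr => s _; rewrite mxE rmorphMn.
by apply/matrixP => i j; rewrite !mxE; case: ifP => _; rewrite E.
Qed.

Lemma map_edge_mx (K L : comNzRingType) (h : {rmorphism K -> L}) n (u v : 'I_n) :
  map_mx h (edge_mx u v K) = edge_mx u v L.
Proof. by rewrite map_mxD !map_delta_mx. Qed.

(** * The Gibbs variety as the closure of a polynomial image *)

(** Polynomials in the matrices supported on the graph, the latter being
    normalized by an affine substitution. *)
Definition gibbs_param (K : comNzRingType) n (e : rel 'I_n) u v
    (x : 'rV[K]_(n + #|free_entries e u v|)) : 'rV[K]_#|upper_index n| :=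
  sym_coord (matpoly (lsubmx x) (edge_mx u v K + free_mx (rsubmx x))).

Lemma polymap_gibbs_param (K : comNzRingType) n (e : rel 'I_n) u v :
  polymap (@gibbs_param K n e u v).
Proof.
apply: polymap_sym_coord; apply: polymx_matpoly => [k|].
  by apply: eq_polyfun (polyfun_coord K (lshift _ k)) => x; rewrite mxE.
apply: polymxD; first exact: polymx_cst.
apply: polymx_free_mx => k.
by apply: eq_polyfun (polyfun_coord K (rshift _ k)) => x; rewrite mxE.
Qed.

Lemma graph_supportedD (K : comNzRingType) n (e : rel 'I_n) (a : K) A B :
  graph_supported e A -> graph_supported e B -> graph_supported e (A + a *: B).
Proof.
move=> [symA suppA] [symB suppB]; split=> [|i j ne_ij neij].
  by rewrite linearD linearZ /= symA symB.
by rewrite !mxE suppA // suppB // mulr0 addr0.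
Qed.

Section GibbsVariety.
Variables (R : realType) (n : nat) (e : rel 'I_n.+1) (u v : 'I_n.+1).
Hypotheses (sym_e : ssrbool.symmetric e) (ltuv : (u < v)%N) (euv : e u v).
Local Notation C := (complex R).
Local Notation rc := (real_complex R).
Local Notation E0 := (edge_mx u v C).
Local Notation psi := (@gibbs_param C n.+1 e u v).

(** A supported matrix is an affine function of a normalized one if its entry at
    [(u, v)] is nonzero. On the line [X + t *: E0] this holds for all [t] but one,
    and the value of [f] is polynomial in [t], hence zero at [t = 0] too. *)
Lemma vanish_supported (f : 'rV[C]_#|upper_index n.+1| -> C)
    (X : 'M[C]_n.+1) (c : 'rV[C]_n.+1) :
  polyfun f -> (forall x, f (psi x) = 0) -> graph_supported e X ->
  f (sym_coord (matpoly c X)) = 0.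
Proof.
move=> Hf f0 suppX.
pose h (x : 'rV[C]_1) := f (sym_coord (matpoly c (X + x 0 0 *: E0))).
have Hh : polyfun h.
  pose phi (x : 'rV[C]_1) := sym_coord (matpoly c (X + x 0 0 *: E0)).
  suff : polyfun (f \o phi) by []; apply: polyfun_comp => //.
  apply: polymap_sym_coord; apply: polymx_matpoly => [k|]; first exact: polyfun_const.
  apply: polymxD; first exact: polymx_cst.
  by apply: polymxZ; [exact: polyfun_coord | exact: polymx_cst].
have [q Hq] := polyfun_line 0 (const_mx 1) Hh.
have hE t : q.[t] = f (sym_coord (matpoly c (X + t *: E0))).
  by rewrite -Hq /h !mxE add0r mulr1.
suff q0 : ('X + (X u v)%:P) * q = 0.
  have -> : sym_coord (matpoly c X) = sym_coord (matpoly c (X + 0 *: E0)).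
    by rewrite scale0r addr0.
  rewrite -hE; move/eqP: q0; rewrite mulf_eq0 => /orP[|/eqP->]; last by rewrite horner0.
  by rewrite -size_poly_eq0 size_XaddC.
apply: poly_nat_roots => k; rewrite hornerM hornerD hornerX hornerC hE.
set t : C := k%:R; have [-> | beta0] := eqVneq (t + X u v) 0; first by rewrite mul0r.
apply/eqP; rewrite mulf_eq0; apply/orP; right; apply/eqP.
set beta := t + X u v in beta0 *; pose alpha := X u u.
pose Y := beta^-1 *: (X + t *: E0 - alpha%:M).
have suppY : graph_supported e (Y + (-1) *: E0).
  apply: graph_supportedD; last exact: edge_mx_supported.
  have [symZ suppZ] := graph_supportedD t suppX (edge_mx_supported sym_e ltuv euv C).
  split=> [|i j ne_ij neij]; first by rewrite linearZ /= linearB /= symZ tr_scalar_mx.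
  by rewrite mxE [X in _ * X]mxE suppZ // !mxE (negPf ne_ij) subrr mulr0.
have uv : (u == v) = false by rewrite -val_eqE /= ltn_eqF.
have [b Eb] : exists b : 'rV[C]_#|free_entries e u v|, Y + (-1) *: E0 = free_mx b.
  have YE (E : 'M[C]_n.+1) i j : (beta^-1 *: (X + t *: E - alpha%:M) + (-1) *: E) i j =
      beta^-1 * (X i j + t * E i j - alpha *+ (i == j)) - E i j.
    by rewrite !mxE mulN1r.
  apply: free_mx_surj suppY _ _; rewrite YE.
    by rewrite edge_mx_uu // mulr0 addr0 eqxx mulr1n subrr mulr0 subr0.
  by rewrite edge_mx_uv // uv mulr1 subr0 addrC [X u v + t]addrC mulVf // addNr.
have EX : X + t *: E0 = alpha%:M + beta *: Y.
  have EZ (Z : 'M[C]_n.+1) : Z = alpha%:M + beta *: (beta^-1 *: (Z - alpha%:M)).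
    by rewrite scalerA mulfV // scale1r [RHS]addrC subrK.
  exact: EZ.
have [c' Hc'] := matpoly_in_affine c Y alpha beta.
rewrite EX Hc' -(f0 (row_mx c' b)) /gibbs_param row_mxKl row_mxKr -Eb.
by rewrite scaleN1r addrCA subrr addr0.
Qed.

Lemma gibbs_variety_param :
  gibbs_variety (graph_space R e) = zariski_closure (range psi).
Proof.
apply/seteqP; split; apply: zariski_closure_min; try exact: zariski_closure_closed.
  move=> _ [A [symA suppA] <-]; apply/zariski_closureP => f Hf f0.
  have [c ->] := expmx_matpoly symA.
  apply: vanish_supported => // [x|]; first by apply: f0; exists x.
  split=> [|i j ne_ij neij]; first by rewrite map_trmx symA.
  by rewrite mxE suppA // rmorph0.
move=> _ [x _ <-]; apply/zariski_closureP => f Hf f0; move: x.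
apply: polyfun_nat_zero; first exact: polyfun_comp Hf (@polymap_gibbs_param C _ e u v).
move=> y; rewrite /gibbs_param; set x := (\row_i _ : 'rV[C]_(n.+1 + _)).
pose b := rsubmx (\row_i (y i)%:R : 'rV[R]_(n.+1 + #|free_entries e u v|)).
have -> : rsubmx x = map_mx rc b by apply/rowP => i; rewrite !mxE rmorph_nat.
rewrite -(map_edge_mx rc) -map_free_mx -map_mxD.
apply: (@vanish_on_matpoly R n (graph_space R e)) => //.
- by move=> A [].
- move=> a a' A B [symA suppA] [symB suppB]; split=> [|i j ne_ij neij].
    by rewrite linearD !linearZ /= symA symB.
  by rewrite !mxE suppA // suppB // !mulr0 addr0.
- move=> d; split=> [|i j ne_ij _]; first by rewrite tr_diag_mx.
  by rewrite mxE (negPf ne_ij).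
- by move=> A LA; apply: f0; exists A.
rewrite -[free_mx b]scale1r; apply: graph_supportedD.
  exact: edge_mx_supported.
exact: free_mx_supported.
Qed.

End GibbsVariety.

Lemma trmx_matpoly (K : comNzRingType) n d (c : 'rV[K]_d) (X : 'M[K]_n) :
  X^T = X -> (matpoly c X)^T = matpoly c X.
Proof.
move=> symX; rewrite /matpoly raddf_sum /=; apply: eq_bigr => k _.
rewrite linearZ /=; congr (_ *: _); elim: (nat_of_ord k) => [|l IH].
  by rewrite expr0 trmx1.
by rewrite [in LHS]exprS -mulmxE trmx_mul IH symX mulmxE -exprSr.
Qed.

Lemma matpoly_comm (K : comNzRingType) n d (c : 'rV[K]_d) (X : 'M[K]_n) :
  X *m matpoly c X = matpoly c X *m X.
Proof.
rewrite mulmx_sumr mulmx_suml; apply: eq_bigr => k _.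
by rewrite -scalemxAr -scalemxAl !mulmxE -exprS -exprSr.
Qed.

Lemma matpoly_linear (K : comNzRingType) n d a (x y : 'rV[K]_d) (X : 'M[K]_n) :
  matpoly (a *: x + y) X = a *: matpoly x X + matpoly y X.
Proof.
rewrite /matpoly scaler_sumr -big_split; apply: eq_bigr => k _ /=.
by rewrite !mxE scalerDl scalerA.
Qed.

Lemma matpoly_delta (K : comNzRingType) n d (i : 'I_d) (X : 'M[K]_n) :
  matpoly (delta_mx 0 i) X = X ^+ i.
Proof.
rewrite /matpoly (bigD1 i) //= mxE !eqxx scale1r big1 ?addr0 // => k ne_k.
by rewrite mxE (negPf ne_k) andbF scale0r.
Qed.

Lemma sym_coord_linear (K : comNzRingType) n a (X Y : 'M[K]_n) :
  sym_coord (a *: X + Y) = a *: sym_coord X + sym_coord Y.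
Proof. by apply/rowP => k; rewrite /sym_coord !mxE. Qed.

(** * The dimension of the Gibbs variety of a tree *)

Section Immersion.
Variables (K : numFieldType) (n : nat) (e : rel 'I_n) (u v : 'I_n).
Hypotheses (tree_e : is_tree e) (n_gt1 : (1 < n)%N) (ltuv : (u < v)%N) (euv : e u v).
Local Notation psi := (@gibbs_param K n e u v).

(** The adjacency matrix plus [s^-1] times a diagonal matrix with distinct entries,
    where [s] is given by [exists_powers_free]; the choice [i - u] of these entries
    makes the one at [(u, u)] vanish. *)
Lemma exists_generic_matrix : exists b : 'rV[K]_#|free_entries e u v|,
  let A := edge_mx u v K + free_mx b in
  (forall x y, e x y -> A x y != 0) /\ (forall c : 'rV[K]_n, matpoly c A = 0 -> c = 0).
Proof.
have uv : (u == v) = false by rewrite -val_eqE /= ltn_eqF.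
pose d := \row_i ((i : 'I_n)%:R - u%:R : K).
have d_inj i j : d 0 i = d 0 j -> i = j.
  by rewrite !mxE => /addIr/eqP; rewrite eqr_nat => /eqP/val_inj.
pose Adj : 'M[K]_n := \matrix_(i, j) (e i j)%:R.
have [s s0 Hs] := exists_powers_free Adj d_inj.
pose A := s^-1 *: (diag_mx d + s *: Adj).
have AE i j : A i j = s^-1 * (d 0 i *+ (i == j)) + (e i j)%:R.
  by rewrite !mxE mulrDr mulKf.
have suppA : graph_supported e A.
  split=> [|i j ne_ij neij]; last by rewrite AE (negPf ne_ij) (negPf neij) mulr0 addr0.
  rewrite /A linearZ linearD linearZ /= tr_diag_mx; congr (_ *: (_ + _ *: _)).
  by apply/matrixP => i j; rewrite !mxE (tree_sym tree_e).
have [b Eb] : exists b : 'rV[K]_#|free_entries e u v|, A + (-1) *: edge_mx u v K = free_mx b.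
  apply: free_mx_surj.
  - by apply: graph_supportedD => //; apply: edge_mx_supported => //; exact: tree_sym.
  - rewrite mxE [X in _ + X]mxE edge_mx_uu // AE mxE subrr mul0rn.
    by rewrite !mulr0 (tree_irr tree_e) !addr0.
  rewrite mxE [X in _ + X]mxE edge_mx_uv // AE uv mulr0n mulr0 euv add0r mulr1.
  by rewrite subrr.
have EA : edge_mx u v K + free_mx b = A by rewrite -Eb scaleN1r addrCA subrr addr0.
exists b; rewrite /= EA; split=> [x y exy|c].
  by rewrite AE (negPf (tree_neq tree_e exy)) mulr0 exy add0r oner_eq0.
pose c' := \row_(k < n) (c 0 k * s^-1 ^+ k).
have -> : matpoly c A = matpoly c' (diag_mx d + s *: Adj).
  apply: eq_bigr => k _; rewrite mxE -scalerA; congr (_ *: _).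
  elim: (nat_of_ord k) => [|l IH]; first by rewrite !expr0 scale1r.
  by rewrite !exprS IH /A -!mulmxE -scalemxAl -scalemxAr scalerA.
move=> /Hs c'0; apply/rowP => k; move/rowP: c'0 => /(_ k); rewrite !mxE => /eqP.
by rewrite mulf_eq0 expf_eq0 invr_eq0 (negPf s0) andbF orbF => /eqP.
Qed.

(** At the pair of the polynomial ['X] and of a generic matrix [A], the derivative
    of the parametrization maps [(c, B)] to [c(A) + B]. If this vanishes then [B]
    commutes with [A], so that it is [alpha%:M + beta *: A], and the
    normalization of [B] makes both scalars vanish. *)
Lemma gibbs_param_immersion : exists (p : 'rV[K]_(n + #|free_entries e u v|))
    (Lam : 'M[K]_(#|upper_index n|, n + #|free_entries e u v|)),
  forall a j, exists q : {poly K}, forall t,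
    ((psi (p + t *: a) - psi p) *m Lam) 0 j = t * (a 0 j + t * q.[t]).
Proof.
have sym_e := tree_sym tree_e.
have [b0 [A_edge A_free]] := exists_generic_matrix.
set A := edge_mx u v K + free_mx b0 in A_edge A_free.
have suppA : graph_supported e A.
  rewrite /A -[free_mx b0]scale1r; apply: graph_supportedD.
    exact: edge_mx_supported.
  exact: free_mx_supported.
pose tau (a : 'rV[K]_(n + #|free_entries e u v|)) :=
  sym_coord (matpoly (lsubmx a) A + free_mx (rsubmx a)).
have [J HJ] : exists J, forall a, tau a = a *m J.
  apply: rV_linear_mx => r x y; rewrite /tau -sym_coord_linear; congr sym_coord.
  rewrite !linearP /= matpoly_linear free_mx_linear scalerDr -!addrA; congr (_ + _).
  by rewrite addrCA.
have freeJ : row_free J.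
  apply/inj_row_free => a; rewrite -HJ /tau.
  set c := lsubmx a; set B := free_mx _ => aJ.
  have [symB suppB] : graph_supported e B by apply: free_mx_supported.
  have cB : matpoly c A + B = 0.
    apply: sym_coord_inj; first by rewrite linearD /= trmx_matpoly ?symB //; case: suppA.
      by rewrite trmx0.
    by rewrite aJ; apply/rowP => k; rewrite !mxE.
  have EB : B = - matpoly c A by apply/eqP; rewrite -addr_eq0 addrC cB.
  have AB : A *m B = B *m A by rewrite EB mulmxN mulNmx matpoly_comm.
  have [symA suppA'] := suppA.
  have [alpha [beta EB']] := tree_commutant tree_e symA symB suppA' suppB A_edge AB n_gt1.
  have uv : (u == v) = false by rewrite -val_eqE /= ltn_eqF.
  have BE i j : B i j = alpha *+ (i == j) + beta * A i j.
    by rewrite EB'; clearbody A; rewrite !mxE.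
  have AE i j : A i j = edge_mx u v K i j + free_mx b0 i j by rewrite /A mxE.
  have alpha0 : alpha = 0.
    have := BE u u; rewrite AE edge_mx_uu // /B !free_mx_uu // eqxx.
    by rewrite mulr1n !addr0 mulr0 addr0.
  have beta0 : beta = 0.
    have := BE u v; rewrite AE edge_mx_uv // /B !free_mx_uv // uv.
    by rewrite mulr0n addr0 mulr1 add0r.
  have B0 : B = 0.
    apply/matrixP => i j; rewrite BE alpha0 beta0 mul0rn mul0r addr0.
    by rewrite [RHS]mxE.
  rewrite -[a]hsubmxK (free_mx_inj B0) [lsubmx a](A_free c) ?row_mx0 //.
  by move: cB; rewrite B0 addr0.
(* The first block of the point encodes the polynomial ['X]. *)
exists (row_mx (delta_mx 0 (Ordinal n_gt1)) b0), (pinvmx J) => a j.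
pose h (x : 'rV[K]_(n + #|free_entries e u v|)) := (sym_coord
  (free_mx (rsubmx a) + matpoly (lsubmx a) (A + free_mx (rsubmx x))) *m pinvmx J) 0 j.
have Hh : polyfun h.
  pose phi (x : 'rV[K]_(n + #|free_entries e u v|)) := sym_coord
    (free_mx (rsubmx a) + matpoly (lsubmx a) (A + free_mx (rsubmx x))).
  pose g (y : 'rV[K]_#|upper_index n|) := (y *m pinvmx J) 0 j.
  suff : polyfun (g \o phi) by []; apply: polyfun_comp.
    by apply: eq_polyfun (polymap_affine 0 (pinvmx J) j) => y; rewrite add0r.
  apply: polymap_sym_coord; apply: polymxD; first exact: polymx_cst.
  apply: polymx_matpoly => [k|]; first exact: polyfun_const.
  apply: polymxD; first exact: polymx_cst.
  apply: polymx_free_mx => k.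
  by apply: eq_polyfun (polyfun_coord K (rshift _ k)) => x; rewrite mxE.
have [q0 Hq0] := polyfun_line 0 a Hh.
have q00 : q0.[0] = a 0 j.
  rewrite -Hq0 scale0r addr0 /h !raddf0.
  have -> : free_mx (0 : 'rV[K]_#|free_entries e u v|) = 0.
    have := @free_mx_linear n e u v K (-1) 0 0.
    by rewrite scaler0 addr0 scaleN1r addNr.
  by rewrite addr0 addrC -/(tau a) HJ mulmxKp.
have [q Hq] := poly_value0 q00; exists q => t; rewrite -Hq -Hq0 add0r.
have free0 : free_mx (0 : 'rV[K]_#|free_entries e u v|) = 0.
  by have := @free_mx_linear n e u v K (-1) 0 0; rewrite scaler0 addr0 scaleN1r addNr.
have freeZ (b : 'rV[K]_#|free_entries e u v|) : free_mx (t *: b) = t *: free_mx b :> 'M[K]_n.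
  by have := @free_mx_linear n e u v K t b 0; rewrite addr0 free0 addr0.
have matpoly0 X : matpoly (0 : 'rV[K]_n) X = 0 :> 'M[K]_n.
  by apply: big1 => k _; rewrite mxE scale0r.
have matpolyZ c X : matpoly (t *: c : 'rV[K]_n) X = t *: matpoly c X :> 'M[K]_n.
  by have := matpoly_linear t c 0 X; rewrite addr0 matpoly0 addr0.
have Epsi x : psi (row_mx (delta_mx 0 (Ordinal n_gt1)) b0 + x) =
    sym_coord (A + free_mx (rsubmx x) + matpoly (lsubmx x) (A + free_mx (rsubmx x))).
  rewrite /gibbs_param !linearD /= row_mxKl row_mxKr.
  rewrite -[delta_mx _ _]scale1r -[b0]scale1r matpoly_linear free_mx_linear !scale1r.
  by rewrite addrA matpoly_delta expr1.
have -> : psi (row_mx (delta_mx 0 (Ordinal n_gt1)) b0) = sym_coord A.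
  by rewrite -[row_mx _ _]addr0 Epsi !raddf0 free0 matpoly0 !addr0.
rewrite Epsi /h !linearZ /= freeZ matpolyZ -addrA -scalerDr [_ + t *: _]addrC.
by rewrite sym_coord_linear addrK -scalemxAl mxE.
Qed.

End Immersion.

Theorem theorem4p1 (R : realType) (n : nat) (G : rel 'I_n) :
  (2 <= n)%N -> is_tree G ->
  zariski_dim R (gibbs_variety (graph_space R G)) = (((3 * n - 3)%N)%:R%:E)%R.
Proof.
case: n G => // n G n_gt1 tree_G.
have [u [v [ltuv euv]]] := tree_edge tree_G n_gt1.
rewrite (gibbs_variety_param R (tree_sym tree_G) ltuv euv).
have [p [Lam HLam]] := gibbs_param_immersion (complex R) tree_G n_gt1 ltuv euv.
rewrite (zariski_dim_immersion R (@polymap_gibbs_param _ _ G u v) HLam).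
congr (_%:R%:E); have := card_free_entries ltuv euv.
have := card_edge_set tree_G isT; lia.
Qed.
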